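(* Let $n\ge 1$ be an integer. The $h$-complex $\Delta_n$ has a discrete Morse function with $m_i=0$ for all $i$ with $3i+4<n$; that is, there is an acyclic matching on the face poset $F(\Delta_n)$ having no unmatched face of dimension $i$ whenever $3i+4<n$. Consequently $\Delta_n$ is $\left\lfloor\frac{n-5}{3}\right\rfloor$-connected.
   Context: For an integer $n\ge 1$ let $B_n$ be the poset of all subsets of $[n]=\{1,\dots,n\}$ ordered by inclusion, and let $\hat{B}_n=B_n\setminus\{\emptyset,[n]\}$. For $\pi=\pi_1\cdots\pi_n\in S_n$ let $$\sigma_\pi=\{\{\pi_1,\dots,\pi_i\} : 1\le i\le n-1,\ \pi_i>\pi_{i+1}\},$$ a chain in $\hat{B}_n$. These are the minimal faces of the standard lexicographic shelling of the order complex $\Delta(\hat{B}_n)$, and $\Delta_n=\{\sigma_\pi : \pi\in S_n\}$ is a subcomplex of $\Delta(\hat{B}_n)$, called the $h$-complex of $\hat{B}_n$. The identity permutation gives the empty face, of dimension $-1$; in general $\dim\sigma_\pi$ is the number of descents of $\pi$ minus $1$. The face poset $F(\Delta)$ of a simplicial complex $\Delta$ is the set of faces, including the empty face, ordered by inclusion. A matching on $F(\Delta)$ is a set of pairwise disjoint pairs $\{\sigma,\tau\}$ with $\tau$ covering $\sigma$. It is acyclic if orienting the matching edges of the Hasse diagram upward (from smaller to larger face) and all other edges downward yields a directed graph without directed cycles. An acyclic matching gives a discrete Morse function whose critical cells are the unmatched faces; $m_i$ denotes the number of unmatched faces of dimension $i$. A space is $(-1)$-connected if it is nonempty; $j$-connectedness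 for $j\le -2$ is a vacuous condition. *)

(* Defs.v *)
From mathcomp Require Import all_boot all_order all_algebra perm.
From mathcomp Require Import all_classical all_reals all_analysis.

Set Implicit Arguments.
Unset Strict Implicit.
Unset Printing Implicit Defensive.

Import Order.TTheory GRing.Theory Num.Theory.
Import numFieldNormedType.Exports.

Local Open Scope ring_scope.

(** A finite abstract simplicial complex on the finite type [V] is given by its
    set of faces [K : {set {set V}}], the empty face included. *)

(* The ground set [n] = {1, ..., n} is represented by 'I_n = {0, ..., n-1}, with
   the same order.  With i and j = i + 1 two consecutive positions (0-based),
   a descent at i contributes the set of the values at positions 0, ..., i. *)
Definition descent_chain (n : nat) (p : 'S_n) : {set {set 'I_n}} :=
  [set p @: [set k : 'I_n | (k <= i)%N]
     | i : 'I_n & [exists j : 'I_n, (j == i.+1 :> nat) && (p j < p i)%N]]%SET.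

Definition h_complex (n : nat) : {set {set {set 'I_n}}} :=
  [set descent_chain p | p : 'S_n]%SET.

Definition face_dim (V : finType) (s : {set V}) : int := #|s|%:Z - 1.

Definition covers (V : finType) (K : {set {set V}}) (s t : {set V}) : bool :=
  [&& s \in K, t \in K, s \proper t
    & [forall r in K, ~~ ((s \proper r) && (r \proper t))]].

Definition is_matching (V : finType) (K : {set {set V}})
    (M : {set {set {set V}}}) : bool :=
  finset.trivIset M &&
  [forall e in M, exists s, exists t, covers K s t && (e == [set s; t]%SET)].

Definition morse_arc (V : finType) (K : {set {set V}})
    (M : {set {set {set V}}}) : rel {set V} :=
  fun x y => (covers K x y && ([set x; y]%SET \in M))
          || (covers K y x && ([set x; y]%SET \notin M)).

Definition acyclic_matching (V : finType) (K : {set {set V}})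
    (M : {set {set {set V}}}) : Prop :=
  is_matching K M /\
  forall c : seq {set V}, path.cycle (morse_arc K M) c -> c = [::].

(* m_i: the number of unmatched faces of dimension i. *)
Definition critical_number (V : finType) (K : {set {set V}})
    (M : {set {set {set V}}}) (i : int) : nat :=
  #|[set s in K :\: finset.cover M | face_dim s == i]%SET|.

Local Open Scope classical_set_scope.

(* Barycentric coordinates; [V] is finite, so {ptws V -> R} is R^V with its
   usual topology. *)
Definition geometric_realization (R : realType) (V : finType)
    (K : {set {set V}}) : set {ptws V -> R} :=
  [set x : {ptws V -> R} | [/\ forall v, 0 <= x v, \sum_v x v = 1
                             & [set v | x v != 0]%SET \in K]].

Arguments geometric_realization R {V} K.

(* MathComp-Analysis norms matrices by the maximum of the entries; the Euclidean
   sphere and ball are therefore spelled out. *)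
Definition unit_sphere (R : realType) (d : nat) : set 'rV[R]_d :=
  [set x : 'rV[R]_d | \sum_i x ord0 i ^+ 2 = 1].

Definition unit_ball (R : realType) (d : nat) : set 'rV[R]_d :=
  [set x : 'rV[R]_d | \sum_i x ord0 i ^+ 2 <= 1].

Arguments unit_sphere : clear implicits.
Arguments unit_ball : clear implicits.

(* The subspace [A] of [T] is k-connected: it is nonempty if k >= -1, and for
   0 <= j <= k every continuous map from the j-sphere to [A] extends to a
   continuous map from the (j+1)-ball to [A]. *)
Definition k_connected (R : realType) (T : topologicalType) (k : int)
    (A : set T) : Prop :=
  (- 1 <= k -> A !=set0) /\
  forall j : nat, j%:Z <= k ->
  forall f : 'rV[R]_j.+1 -> T,
    {within unit_sphere R j.+1, continuous f} ->
    f @` unit_sphere R j.+1 `<=` A ->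
    exists g : 'rV[R]_j.+1 -> T,
      [/\ {within unit_ball R j.+1, continuous g},
          g @` unit_ball R j.+1 `<=` A
        & forall x, unit_sphere R j.+1 x -> g x = f x].

(* Main.v *)
(** A face is an ordered set partition [B_1 | ... | B_k] of [n] with
    [max B_i > min B_(i+1)], and its facets merge two consecutive blocks.  Scan
    the blocks from the left, [M] being the maximum of the previous block and
    [M = infinity] at the start, and toggle at the first place where this is
    possible: a block [b_1 < b_2 < ...] is split into [b_2 | b_1 b_3 b_4 ...] if
    [b_2 < M], and into [b_1 b_3 | b_2 b_4 ...] otherwise; conversely such a pair
    of blocks is merged.  A block at which nothing can be toggled has at most 3
    elements, at most 2 if it is the first or the last one, at most 1 if it is
    both.  Hence an unmatched face with [k] blocks satisfies [n <= 3 k - 2].  The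
    matching is acyclic because a suitable ranking of the blocks decreases
    lexicographically along alternating paths.

    An acyclic matching builds the complex from a vertex by elementary expansions
    and by attaching critical cells, here of dimension [> k].  A map from the
    [j]-sphere, [j <= k], is pushed back through these steps until it is constant.
    Each push moves points along segments inside one simplex.  For an expansion it
    is an explicit retraction.  For a critical cell the map is first replaced,
    inside the cell, by a Lipschitz approximation; the sphere being a union of
    O(N^j) sets of diameter O(1/N), this misses a point of the cell, from which
    one projects to the boundary. *)

Require Import Defs.
From mathcomp Require Import all_boot all_order all_algebra perm ring lra zify.
Set Implicit Arguments.
Unset Strict Implicit.
Unset Printing Implicit Defensive.
Local Open Scope nat_scope.

(** * The matching on block lists *)

(* A face is encoded by the list of blocks of its ordered set partition, each
   block an increasing list; [M] stands for the maximum of a preceding block. *)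
Fixpoint heads_below (M : nat) (bs : seq (seq nat)) : bool :=
  if bs is B :: r then (head 0 B < M) && heads_below (last 0 B) r else true.

Definition blockb (B : seq nat) : bool := (B != [::]) && sorted ltn B.

(** Which numbers occur is left open, so that a tail of a valid list is valid for the maximum of the
    removed block; [full] adds that they exhaust [n]. *)
Definition valid (M : nat) (bs : seq (seq nat)) : bool :=
  [&& all blockb bs, uniq (flatten bs) & heads_below M bs].

Inductive merged : seq (seq nat) -> seq (seq nat) -> Prop :=
| merged_here E F q : merged (merge leq E F :: q) (E :: F :: q)
| merged_there B s t : merged s t -> merged (B :: s) (B :: t).

(* The block [B] following a block of maximum [M] (the last block of the list if
   [is_last]) is split into [b2 | b1 b3 b4 ..] or [b1 b3 | b2 b4 ..]; [mergeable]
   recognizes the results. *)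
Definition split_block (M : nat) (B : seq nat) (is_last : bool) :=
  match B with
  | b1 :: b2 :: r =>
    if b2 < M then
      if (r != [::]) || is_last then Some ([:: b2], b1 :: r) else None
    else if r is b3 :: r' then
      if (r' != [::]) || is_last then Some ([:: b1; b3], b2 :: r') else None
    else None
  | _ => None
  end.

Definition mergeable (M : nat) (E F : seq nat) (is_last : bool) : bool :=
  let fits z := if F is _ :: f2 :: _ then z < f2 else is_last in
  match E with
  | [:: x] => fits x
  | [:: x; z] => (M <= head 0 F) && fits z
  | _ => false
  end.

(** The boolean is the direction: [true] if the partner is the larger face, found by a split,
    [false] if it is found by a merge. *)
Fixpoint partner (M : nat) (bs : seq (seq nat)) : option (bool * seq (seq nat)) :=
  if bs is B :: rest then
    if split_block M B (nilp rest) is Some (H, R) then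
      Some (true, H :: R :: rest)
    else if rest is F :: rest' then
      if mergeable M B F (nilp rest') then
        Some (false, merge leq B F :: rest')
      else if partner (last 0 B) rest is Some (u, s) then Some (u, B :: s)
      else None
    else None
  else None.

Lemma partnerE M B rest : partner M (B :: rest) =
  if split_block M B (nilp rest) is Some (H, R) then Some (true, H :: R :: rest)
  else if rest is F :: rest' then
    if mergeable M B F (nilp rest') then Some (false, merge leq B F :: rest')
    else if partner (last 0 B) rest is Some (u, s) then Some (u, B :: s) else None
  else None.
Proof. by []. Qed.

Lemma valid_cons M B r :
  valid M (B :: r) -> [/\ blockb B, head 0 B < M, valid (last 0 B) r
                        & uniq (B ++ flatten r)].
Proof.
rewrite /valid /= => /and3P[/andP[-> ->]] u /andP[-> ->].
by split=> //; move: u; rewrite cat_uniq => /and3P[_ _ ->].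
Qed.

Lemma valid_consI M B r :
  blockb B -> head 0 B < M -> valid (last 0 B) r -> uniq (B ++ flatten r) ->
  valid M (B :: r).
Proof. by rewrite /valid /= => -> -> /and3P[-> _ ->] ->. Qed.

Lemma blockb_merge E F : blockb E -> blockb F -> uniq (E ++ F) ->
  blockb (merge leq E F).
Proof.
move=> /andP[E0 sE] /andP[_ sF] u; apply/andP; split.
  rewrite -size_eq0 size_merge size_cat.
  by case: E E0 {sE u}.
rewrite ltn_sorted_uniq_leq; apply/andP; split.
  by rewrite (perm_uniq (permEl (perm_merge _ _ _))).
move: sE sF; rewrite !ltn_sorted_uniq_leq => /andP[_ sE] /andP[_ sF].
by apply: merge_sorted => //; exact: leq_total.
Qed.

Lemma head_merge E F M : E != [::] -> head 0 E < M -> head 0 (merge leq E F) < M.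
Proof.
case: E => [|e E] //= _; case: F => [|f F] //=.
by case: (leqP e f) => /= ? ?; lia.
Qed.

Lemma last_path_ltn x s : path ltn x s -> x <= last x s.
Proof.
elim: s x => //= y s IH x /andP[xy /IH]; apply: leq_trans; exact: ltnW.
Qed.

Lemma mem_sorted_le_last s x : sorted ltn s -> x \in s -> x <= last 0 s.
Proof.
case: s => //= y s sy; rewrite inE => /orP[/eqP->|xs].
  exact: last_path_ltn.
elim: s y sy xs => //= z s IH y /andP[_ sz]; rewrite inE => /orP[/eqP->|].
  exact: last_path_ltn.
exact: IH.
Qed.

Lemma last_merge E F : blockb E -> blockb F -> uniq (E ++ F) ->
  last 0 F <= last 0 (merge leq E F).
Proof.
move=> bE bF u; have /andP[_ sG] := blockb_merge bE bF u.
apply: mem_sorted_le_last => //; rewrite mem_merge mem_cat; apply/orP; right.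
by case/andP: bF; case: F {u sG} => //= f F _ _; exact: mem_last.
Qed.

Lemma heads_below_le M M' bs : M <= M' -> heads_below M bs -> heads_below M' bs.
Proof.
by case: bs => //= B r MM /andP[h ->]; rewrite andbT; exact: leq_trans MM.
Qed.

Lemma merged_flatten s t : merged s t -> perm_eq (flatten s) (flatten t).
Proof.
elim=> [E F q|B {}s {}t _ IH] /=; last by rewrite perm_cat2l.
rewrite catA perm_cat2r; exact: permEl (perm_merge _ _ _).
Qed.

(** The merged block starts no higher than [E] and ends no lower than [F], so the descents on both
    sides of it survive. *)
Lemma merged_valid M s t : merged s t -> valid M t -> valid M s.
Proof.
move=> mst; elim: mst M => [E F q|B {}s {}t m IH] M /valid_cons[bE hE vt u].
  have [bF hF vq uF] := valid_cons vt.
  have uEF : uniq (E ++ F) by move: u; rewrite /= catA cat_uniq => /andP[].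
  apply: valid_consI.
  - exact: blockb_merge.
  - by apply: head_merge => //; case/andP: bE.
  - move: vq; rewrite /valid => /and3P[-> -> /=].
    by apply: heads_below_le; exact: last_merge.
  - rewrite (@perm_uniq _ _ ((E ++ F) ++ flatten q)) -?catA //.
    by rewrite catA perm_cat2r; exact: permEl (perm_merge _ _ _).
apply: valid_consI => //; first exact: IH.
by rewrite (@perm_uniq _ _ (B ++ flatten t)) // perm_cat2l merged_flatten.
Qed.

Lemma merge1l x y r : path ltn x r -> y < x -> merge leq [:: x] (y :: r) = y :: x :: r.
Proof.
move=> p yx /=; rewrite leqNgt yx /=; congr (_ :: _).
by case: r p => //= z r /andP[/ltnW -> _].
Qed.

(** The final alternative protects the next block: unless [B] is last, [R] keeps its maximum. *)
Lemma split_blockP M B lst H R : split_block M B lst = Some (H, R) ->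
  blockb B -> head 0 B < M ->
  [/\ [/\ blockb H, blockb R, merge leq H R = B & mergeable M H R lst],
    head 0 H < M, head 0 R < last 0 H & lst \/ last 0 R = last 0 B].
Proof.
case: B => [|b1 [|b2 r]] //=; case: ifP => [b2M|b2M].
  case: ifP => // c [<- <-] /andP[_ /= /andP[b12 p]] _.
  have p1 : path ltn b1 r.
    by case: r p {c} => //= z r /andP[z2 ->]; rewrite (ltn_trans b12 z2).
  have e : merge leq [:: b2] (b1 :: r) = b1 :: b2 :: r by apply: merge1l.
  split=> //.
    by split=> //; case: r c {p1 e} p => //= z r _ /andP[->].
  by case: r c {p1 e p} => [|z r] /= c; [left|right].
case: r => [|b3 r] //; case: ifP => // c [<- <-] /andP[_ /=].
move=> /and3P[b12 b23 p] b1M.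
have p2 : path ltn b2 r.
  by case: r p {c} => //= z r /andP[z2 ->]; rewrite (ltn_trans b23 z2).
have e : merge leq [:: b1; b3] (b2 :: r) = [:: b1, b2, b3 & r].
  by have /= := merge1l p b23; rewrite (ltnW b12) => ->.
split=> //.
  split=> //=; first by rewrite /blockb /= (ltn_trans b12).
  by rewrite leqNgt b2M /=; case: r c {p2 e} p => //= z r _ /andP[->].
by case: r c {p2 e p} => [|z r] /= c; [left|right].
Qed.

Lemma mergeableP M E F lst : mergeable M E F lst ->
  blockb E -> blockb F -> head 0 E < M -> head 0 F < last 0 E ->
  split_block M (merge leq E F) lst = Some (E, F).
Proof.
case: E => [|x [|z [|? ?]]] //=; case: F => [|f1 F] //=.
  move=> fit _ /andP[_ /= p] xM f1x.
  have p' : path ltn x F by case: F fit p => //= f2 F -> /andP[_ ->].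
  have /= -> := merge1l p' f1x.
  by rewrite /= xM; case: F fit {p p'} => //= ->.
move=> /andP[Mf fit] /andP[_ /= /andP[xz _]] /andP[_ /= p] xM f1z.
have p' : path ltn z F by case: F fit p => //= f2 F -> /andP[_ ->].
have xf : x < f1 by apply: leq_trans Mf.
have /= -> := merge1l p' f1z.
rewrite (ltnW xf) /= ltnNge Mf /=.
by case: F fit {p p'} => //= ->.
Qed.

(** A block that splits without being last has at least three elements, one that can be merged with
    its successor at most two. *)
Lemma split_not_mergeable M B F H R lst : split_block M B false = Some (H, R) ->
  mergeable M B F lst = false.
Proof. by case: B => [|b1 [|b2 [|b3 B]]] //=; case: ifP. Qed.

Lemma mergeable_weak M B F lst : mergeable M B F false -> mergeable M B F lst.
Proof. by case: B => [|b1 [|b2 [|b3 B]]] //=; case: F => [|f1 [|f2 F]] //=; rewrite andbF. Qed.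

Lemma merged_cons s t : merged s t -> [/\ s != [::], t != [::] & nilp (behead t) = false].
Proof. by elim=> // B {}s {}t _ [s0 t0 tb]; split=> //=; case: t t0 tb. Qed.

(* The merge test at [B] sees only the next block, and it fails on the head of a
   split for the same reason as on the block itself. *)
Lemma mergeable_split_next M B F H R lst :
  split_block (last 0 B) F lst = Some (H, R) -> blockb B -> blockb F ->
  uniq (B ++ F) ->
  head 0 B < M -> head 0 F < last 0 B ->
  split_block M B false = None ->
  mergeable M B F lst = mergeable M B H false.
Proof.
case: F => [|f1 [|f2 F]] //= + + /andP[_ /= /andP[f12 p]].
case: B => [|x [|z [|z2 B]]] //=.
- case: ifP => [f2x|f2x].
    by case: ifP => // _ [<- _] /= _ _ _ _ _; rewrite ltnNge (ltnW f2x).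
  case: F p => [|f3 F] //= /andP[f23 p]; case: ifP => // _ [<- _] /= _ u _ _ _.
  have : x != f2 by move: u; rewrite !inE !negb_or => /andP[/and4P[]].
  by move: f2x f23; lia.
- case: ifP => [f2z|f2z].
    by case: ifP => // _ [<- _] /= _ _ _ _ _; rewrite andbF ltnNge (ltnW f2z) andbF.
  case: F p => [|f3 F] //= /andP[f23 p]; case: ifP => // _ [<- _] /= _ u _ _ _.
  have : z != f2.
    by move: u => /and3P[_]; rewrite !inE !negb_or => /and4P[].
  by move: f2z f23; lia.
Qed.

(** Together with [partner_down] this makes the toggle an involution: scanning the result stops at
    the same place. For an earlier block at most the successor has changed, which by
    [mergeable_split_next] does not affect its merge test. *)
Lemma partner_up M s t : valid M s -> partner M s = Some (true, t) ->
  [/\ valid M t, merged s t & partner M t = Some (false, s)].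
Proof.
elim: s M t => [|B rest IH] M t //= /valid_cons[bB hB vr u].
case E: split_block => [[H R]|].
  case=> <-; have [[bH bR mHR mg] hH hR lR] := split_blockP E bB hB.
  have perm : perm_eq (H ++ R) B by rewrite -mHR perm_sym; exact: permEl (perm_merge _ _ _).
  have v : valid M [:: H, R & rest].
    apply: valid_consI => //; last first.
      by rewrite /= catA (@perm_uniq _ _ (B ++ flatten rest)) // perm_cat2r.
    have u' : uniq ((H ++ R) ++ flatten rest).
      by rewrite (@perm_uniq _ _ (B ++ flatten rest)) // perm_cat2r.
    apply: valid_consI => //; last by move: u'; rewrite -catA cat_uniq => /and3P[].
    move: lR => [|->//]; by case: (rest).
  split=> //; first by rewrite -{1}mHR; constructor.
  rewrite /=; case S: split_block => [[H' R']|].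
    by rewrite (split_not_mergeable _ _ S) in mg.
  by rewrite mg mHR.
case: rest IH vr u E => [|F rest'] // IH vr u E.
case: ifP => // nm; case P: partner => [[up t']|] // [eup et]; subst up t.
have [vt mst pt] := IH _ _ vr P.
have v : valid M (B :: t').
  apply: valid_consI => //.
  by rewrite (@perm_uniq _ _ (B ++ flatten (F :: rest'))) // perm_cat2l perm_sym merged_flatten.
split=> //; first by constructor.
have [_ t0 tb] := merged_cons mst.
have [bF hF _ _] := valid_cons vr.
have uBF : uniq (B ++ F) by move: u; rewrite /= catA cat_uniq => /andP[].
have E' : split_block M B (nilp t') = None by case: (t') t0.
rewrite partnerE E'.
case: t' P vt mst pt t0 tb {v E'} => [|F' t'] // P vt mst pt _ tb'.
have {tb'} tb : nilp t' = false := tb'.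
suff -> : mergeable M B F' (nilp t') = false by rewrite pt.
move: P; rewrite partnerE; case S: split_block => [[H R]|].
  case=> <- et; rewrite tb -(mergeable_split_next S bB bF uBF hB hF E) //.
case: rest' S {IH vr u pt E mst} nm => [|F2 rest'] // S nm.
case: ifP => // _; case: partner => [[up t2]|] // [_ <- _].
by rewrite tb.
Qed.

Lemma partner_down M t s : valid M t -> partner M t = Some (false, s) ->
  merged s t /\ partner M s = Some (true, t).
Proof.
elim: t M s => [|B rest IH] M s //= /valid_cons[bB hB vr u].
case E: split_block => [[H R]|] //.
case: rest IH vr u E => [|F rest'] // IH vr u E.
have [bF hF _ _] := valid_cons vr.
have uBF : uniq (B ++ F) by move: u; rewrite /= catA cat_uniq => /andP[].
case: ifP => mg.
  case=> <-; split; first by constructor.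
  by rewrite /= (mergeableP mg).
case P: partner => [[up s']|] // [eup es]; subst up s.
have [mst pt] := IH _ _ vr P.
split; first by constructor.
have [s0 _ _] := merged_cons mst.
have E' : split_block M B (nilp s') = None by case: (s') s0.
rewrite partnerE E'.
case: s' P mst pt s0 {E'} => [|F' s'] // P mst pt _.
suff -> : mergeable M B F' (nilp s') = false by rewrite pt.
have vs := merged_valid mst vr.
have [bF' hF' _ us'] := valid_cons vs.
have uB : uniq (B ++ flatten (F' :: s')).
  by rewrite (@perm_uniq _ _ (B ++ flatten (F :: rest'))) // perm_cat2l merged_flatten.
have uBF' : uniq (B ++ F') by move: uB; rewrite /= catA cat_uniq => /andP[].
move: (pt); rewrite partnerE; case S: split_block => [[H R]|].
  case=> e1 e2; subst F rest'.
  rewrite (mergeable_split_next S bB bF' uBF' hB hF' E).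
  by move: mg; case: (nilp s').
case: s' S {pt mst vs uB us'} P => [|F2 s'] // S P.
case: ifP => // _; case: partner => [[up t2]|] // [_ eF _].
by apply: contraFF mg; rewrite -eF; exact: mergeable_weak.
Qed.

Lemma partner_none_size M s : s != [::] -> valid M s -> partner M s = None ->
  size (flatten s) <= 3 * size s - 1.
Proof.
elim: s M => // B rest IH M _ /valid_cons[bB hB vr u].
rewrite partnerE; case E: split_block => [[H R]|] //.
case: rest IH vr u E => [|F rest'] IH vr u E.
  move=> _ /=; rewrite cats0; case: B bB E {hB u vr} => [|b1 [|b2 [|b3 B]]] //= _.
  by case: ifP => // _; rewrite orbT.
case: ifP => // _; case P: partner => [[]|] // _.
have := IH _ isT vr P; rewrite /= !size_cat.
suff : @size nat B <= 3 by lia.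
by case: B bB E {hB u vr IH P} => [|b1 [|b2 [|b3 [|b4 B]]]] //= _; case: ifP.
Qed.

(** Here [n] plays the infinite maximum: the second element of the first block is below it, so a
    stuck first block has at most two elements, and one if it is also the last. *)
Lemma partner_none n bs : bs != [::] -> valid n bs -> all (ltn^~ n) (flatten bs) ->
  partner n bs = None -> size (flatten bs) <= 3 * size bs - 2.
Proof.
case: bs => // B rest _ /valid_cons[bB hB vr u] al.
rewrite partnerE; case E: split_block => [[H R]|] //.
have B2 : size B <= 2 - (nilp rest).
  case: B bB E al {hB u vr} => [|b1 [|b2 B]] //= _; first by case: nilp.
  move=> + /and3P[_ b2n _]; rewrite (b2n : b2 < n).
  by case: B => //=; case: nilp.
case: rest vr u E B2 al => [|F rest'] vr u E B2 al; first by rewrite /= cats0.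
case: ifP => // _; case P: partner => [[]|] // _.
have := @partner_none_size _ (F :: rest') isT vr P; rewrite /= !size_cat.
by have {}B2 : @size nat B <= 2 := B2; lia.
Qed.

(* Along an alternating path the first block rank that changes goes down.  Blocks
   whose second element is below [M] rank below [2 * n], the others above; the
   odd values place a block just below the one it arises from by a merge. *)
Definition block_rank (n M : nat) (B : seq nat) : nat :=
  match B with
  | [:: x] => 2 * x
  | b1 :: b2 :: r =>
    if b2 < M then (if r is [::] then 2 * b2 - 1 else 0)
    else 2 * n + match r with
                 | [::] => 2 * b2
                 | [:: b3] => 2 * b3 - 1
                 | _ => 0
                 end
  | [::] => 0
  end.

Fixpoint block_ranks (n M : nat) (bs : seq (seq nat)) : seq nat :=
  if bs is B :: r then block_rank n M B :: block_ranks n (last 0 B) r else [::].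

Fixpoint lex_lt (s t : seq nat) : bool :=
  match s, t with
  | x :: s', y :: t' => (x < y) || (x == y) && lex_lt s' t'
  | _, _ => false
  end.

Lemma lex_lt_irr s : lex_lt s s = false.
Proof. by elim: s => //= x s ->; rewrite ltnn eqxx. Qed.

Lemma lex_lt_trans : transitive lex_lt.
Proof.
elim=> [|y t IH] [|x s] [|z u] //= /orP[xy|/andP[/eqP-> st]].
  by move=> /orP[yz|/andP[/eqP<- _]]; rewrite ?xy // (ltn_trans xy yz).
by move=> /orP[->//|/andP[/eqP-> tu]]; rewrite eqxx (IH _ _ st tu) orbT.
Qed.

Lemma partner_head M B rest t : partner M (B :: rest) = Some (true, t) ->
  (exists H R, split_block M B (nilp rest) = Some (H, R) /\ t = H :: R :: rest)
  \/ (split_block M B (nilp rest) = None /\ exists t', t = B :: t').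
Proof.
rewrite partnerE; case: split_block => [[H R] [<-]|]; first by left; exists H, R.
case: rest => // F rest'; case: ifP => // _.
by case: partner => [[up t']|] // [_ <-]; right; split => //; exists t'.
Qed.

Lemma path_ltn_min (x : nat) (s : seq nat) (y : nat) : path ltn x s -> y \in s -> x < y.
Proof. by move=> /(order_path_min ltn_trans)/allP; apply. Qed.

(** How a merged block splits depends on its second and third smallest elements; this lemma and the
    next two bound them by exhibited elements. *)
Lemma sorted_nth1_le (G : seq nat) (a b : nat) : sorted ltn G -> a \in G -> b \in G -> a < b ->
  nth 0 G 1 <= b.
Proof.
case: G => [|g1 G] //= p aG; rewrite inE => /orP[/eqP->|].
  by move: aG; rewrite inE => /orP[/eqP->|/(path_ltn_min p)]; lia.
case: G p aG => [|g2 G] //= /andP[_ p] _.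
by rewrite inE => /orP[/eqP->//|/(path_ltn_min p)/ltnW].
Qed.

Lemma sorted_nth1_lt (G : seq nat) (a b v : nat) : sorted ltn G ->
  a \in G -> b \in G -> a != b -> a < v -> b < v -> nth 0 G 1 < v.
Proof.
move=> sG aG bG; rewrite neq_ltn => /orP[] lt av bv.
  exact: leq_ltn_trans (sorted_nth1_le sG aG bG lt) bv.
exact: leq_ltn_trans (sorted_nth1_le sG bG aG lt) av.
Qed.

Lemma sorted_nth2_le (G : seq nat) (a b c : nat) : sorted ltn G -> a \in G -> b \in G -> c \in G ->
  a < b -> b < c -> nth 0 G 2 <= c.
Proof.
case: G => [|g1 G] //= p aG bG cG ab bc.
have min x : x \in g1 :: G -> g1 <= x.
  by rewrite inE => /orP[/eqP->//|/(path_ltn_min p)/ltnW].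
have ne x : x \in g1 :: G -> a < x -> x \in G.
  by rewrite inE => /orP[/eqP->|//]; have := min _ aG; lia.
apply: (sorted_nth1_le (path_sorted p) _ _ bc).
  exact: ne.
by apply: ne => //; lia.
Qed.

(** Three elements allow the first kind of split even if [G] is not last; the second kind, in
    [partner_head_large], takes four. *)
Lemma partner_head_small M G rest s : 2 < size G -> nth 0 G 1 < M ->
  partner M (G :: rest) = Some (true, s) -> exists r, s = [:: nth 0 G 1] :: r.
Proof.
case: G => [|g1 [|g2 [|g3 G]]] // _ g2M /partner_head.
move: g2M => /= -> [[H [R [[<- _] ->]]]|[]] //.
by eexists.
Qed.

Lemma partner_head_large M G rest s : 3 < size G -> M <= nth 0 G 1 ->
  partner M (G :: rest) = Some (true, s) ->
  exists r, s = [:: nth 0 G 0; nth 0 G 2] :: r.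
Proof.
case: G => [|g1 [|g2 [|g3 [|g4 G]]]] // _ g2M /partner_head.
by move: g2M => /=; rewrite leqNgt => /negbTE-> [[H [R [[<- _] ->]]]|[]] //; eexists.
Qed.

Lemma rank_pair_lt n M x z k : M <= n -> z < k ->
  block_rank n M [:: x; z] < 2 * n + 2 * k - 1.
Proof. by move=> Mn zk /=; case: ifP; lia. Qed.

(* One step [t -> s -> s'] of an alternating path, where [s] merges into its
   successor a block [E] of [t] at which nothing can be toggled. *)
Lemma rank_merge_consumed n M E F rest s' :
  blockb E -> blockb F -> uniq (E ++ F) ->
  head 0 E < M -> M <= n -> head 0 F < last 0 E ->
  split_block M E false = None ->
  mergeable M E F (nilp rest) = false ->
  partner M (merge leq E F :: rest) = Some (true, s') ->
  exists G r, s' = G :: r /\ block_rank n M G < block_rank n M E.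
Proof.
move=> bE bF u hE Mn hF sE mg.
have /andP[_ sG] := blockb_merge bE bF u.
have memG x : (x \in merge leq E F) = (x \in E) || (x \in F).
  by rewrite mem_merge mem_cat.
have szG : size (merge leq E F) = size E + size F by rewrite size_merge size_cat.
case: F bF u hF mg sG memG szG => [|f1 F] // bF u /= hF mg.
move eG: (merge leq E (f1 :: F)) => G sG memG szG.
have f1G : f1 \in G by rewrite memG inE eqxx orbT.
(* [F] now lacks its head [f1], so the size conditions of [small] and [large] give [G] at least
   three and four elements. *)
have small v : 1 < size E + size F -> nth 0 G 1 < M ->
    2 * nth 0 G 1 < v -> partner M (G :: rest) = Some (true, s') ->
    exists G r, s' = G :: r /\ block_rank n M G < v.
  move=> sz g2M lt /partner_head_small-/(_ _ g2M)[|r ->]; first by rewrite szG; lia.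
  by exists [:: nth 0 G 1], r.
have large k : 2 < size E + size F -> nth 0 G 2 < k ->
    partner M (G :: rest) = Some (true, s') ->
    exists G r, s' = G :: r /\ block_rank n M G < 2 * n + 2 * k - 1.
  move=> sz g3 P; case: (ltnP (nth 0 G 1) M) => g2M.
    by apply: small => //; lia.
  have [|r ->] := partner_head_large _ g2M P; first by rewrite szG; lia.
  by exists [:: nth 0 G 0; nth 0 G 2], r; split=> //; exact: rank_pair_lt.
case: E bE u hE hF sE mg eG sG memG szG f1G small large
    => [|x [|y [|z [|? E]]]] //= bE u hE hF sE mg eG sG memG szG f1G small large.
- case: F bF u mg eG sG memG szG f1G small large
    => [|f2 F] /= bF u mg eG sG memG szG f1G small large.
    (* By [mg] the pair is not last. It cannot be split and stays, with the odd rank 2x - 1 just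
       below the rank 2x of [E]. *)
    have -> : G = [:: f1; x] by rewrite -eG leqNgt hF.
    move=> /partner_head[] /=; rewrite mg hE => -[].
      by move=> H [R []].
    by move=> _ [r ->]; exists [:: f1; x], r; rewrite /= hE; split => //; lia.
  have f12 : f1 < f2 by move: bF => /andP[_ /andP[]].
  have f2x : f2 < x.
    have : x != f2 by move: u; rewrite !inE !negb_or => /andP[/and3P[]].
    by move: mg; clear; lia.
  have g2 : nth 0 G 1 <= f2.
    by apply: (sorted_nth1_le sG f1G) f12; rewrite memG !inE eqxx !orbT.
  have g2x := leq_ltn_trans g2 f2x.
  by apply: small => //; [exact: ltn_trans g2x hE|move: g2x; clear; lia].
- have xy : x < y by move: bE => /andP[_ /andP[]].
  have xf1 : x != f1 by move: u; rewrite !inE !negb_or => /andP[/and3P[]].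
  have xG : x \in G by rewrite memG !inE eqxx.
  have yG : y \in G by rewrite memG !inE eqxx orbT.
  have g2 v : x < v -> f1 < v -> nth 0 G 1 < v.
    exact: (sorted_nth1_lt sG xG f1G xf1).
  case: (ltnP y M) => yM.
    have g2y := g2 _ xy hF.
    by apply: small => //; [exact: ltn_trans g2y yM|move: g2y; clear; lia].
  case: (ltnP f1 M) => f1M.
    have g2M := g2 _ hE f1M.
    by apply: small => //; move: g2M Mn; clear; lia.
  case: F bF u mg eG sG memG szG f1G small large xG yG g2
    => [|f2 F] /= bF u mg eG sG memG szG f1G small large xG yG g2.
    (* Again [G] is not last and stays; as a triple of the second kind it ranks one below the pair
       [E]. *)
    have -> : G = [:: x; f1; y] by rewrite -eG (ltnW (leq_trans hE f1M)) leqNgt hF.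
    have f1M' : (f1 < M) = false by rewrite ltnNge f1M.
    move=> /partner_head[] /=; rewrite f1M'; move: mg; rewrite f1M /= => ->.
      by move=> [H [R []]].
    move=> [_ [r ->]]; exists [:: x; f1; y], r; split => //=.
    by rewrite f1M' /=; move: hF; clear; lia.
  have f12 : f1 < f2 by move: bF => /andP[_ /andP[]].
  have f2y : f2 < y.
    have : y != f2 by move: u => /and3P[_]; rewrite !inE !negb_or => /and3P[].
    by move: mg; rewrite f1M; clear; lia.
  have g3 : nth 0 G 2 <= f2.
    have f2G : f2 \in G by rewrite memG !inE eqxx !orbT.
    exact: (sorted_nth2_le sG xG f1G f2G (leq_trans hE f1M)).
  move=> P; have [||//|] := large y; [by []|exact: leq_ltn_trans g3 f2y|].
  by move=> G' [r [-> lt]]; exists G', r; split=> //; move: lt; clear; lia.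
- move: sE; case: (ltnP y M) => // My _.
  have /and3P[xy yz _] : [&& x < y, y < z & true] by case/andP: bE.
  have xf1 : x != f1 by move: u; rewrite !inE !negb_or => /andP[/and4P[]].
  have yf1 : y != f1 by move: u => /and3P[_]; rewrite !inE !negb_or => /and3P[].
  have xG : x \in G by rewrite memG !inE eqxx.
  have yG : y \in G by rewrite memG !inE eqxx orbT.
  case: (ltnP f1 M) => f1M.
    have g2M : nth 0 G 1 < M by exact: (sorted_nth1_lt sG xG f1G xf1 hE f1M).
    by apply: small => //; move: g2M Mn; clear; lia.
  have g3 : nth 0 G 2 < z.
    have xf : x < f1 := leq_trans hE f1M.
    move: yf1; rewrite neq_ltn => /orP[] lt.
      exact: leq_ltn_trans (sorted_nth2_le sG xG yG f1G xy lt) hF.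
    exact: leq_ltn_trans (sorted_nth2_le sG xG f1G yG xf lt) yz.
  move=> P; have [||//|] := large z; [by []|exact: g3|].
  by move=> G' [r [-> lt]]; exists G', r; split=> //; move: lt yz; clear; lia.
- by move: sE; case: ifP.
Qed.

(* The same step when [s] merges the second half [R] of a split block of [t]
   with its successor: [R] has a rank of the second kind, its replacement one of
   the first kind. *)
Lemma rank_merge_remainder n M H R F rest s' :
  valid M [:: H, R, F & rest] -> all (ltn^~ n) H ->
  mergeable M H R false ->
  partner M [:: H, merge leq R F & rest] = Some (true, s') ->
  exists G r, s' = [:: H, G & r] /\
    block_rank n (last 0 H) G < block_rank n (last 0 H) R.
Proof.
move=> v aH mg P.
have [bH hH vR u] := valid_cons v.
have [bR hR vF uR] := valid_cons vR.
have [bF hF _ _] := valid_cons vF.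
have uRF : uniq (R ++ F) by move: uR; rewrite /= catA cat_uniq => /andP[].
have /andP[_ sG] := blockb_merge bR bF uRF.
have memG x : (x \in merge leq R F) = (x \in R) || (x \in F).
  by rewrite mem_merge mem_cat.
have szG : size (merge leq R F) = size R + size F by rewrite size_merge size_cat.
have zH : last 0 H \in H by case/andP: bH; case: (H) => //= h H' _ _; exact: mem_last.
have zG : last 0 H \notin merge leq R F.
  rewrite memG negb_or; apply/andP.
  move: u; rewrite cat_uniq => /and3P[_ /hasPn nH _].
  by split; apply: contraL zH => zR; apply: nH; rewrite /= !mem_cat zR ?orbT.
have zn : last 0 H < n by move/allP: aH => /(_ _ zH).
have r1G : head 0 R \in merge leq R F.
  by rewrite memG; case/andP: bR; case: (R) => //= r R' _ _; rewrite inE eqxx.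
have sz3 : 2 < size (merge leq R F) /\ 2 * n <= block_rank n (last 0 H) R.
  rewrite szG; case/andP: bF; case: (F) => // f F' _ _.
  move: mg; case: (R) => [|r1 [|r2 R']]; rewrite /mergeable.
  - by case: (H) => [|? [|? []]] //; rewrite andbF.
  - by case: (H) => [|? [|? []]] //; rewrite andbF.
  move=> mg; suff zr : (r2 < last 0 H) = false.
    by rewrite /block_rank zr leq_addr; split=> //=; clear; lia.
  by move: mg; case: (H) => [|x [|z []]] //= => [|/andP[_]]; clear; lia.
move: sz3 => [sz3 rkR].
case: (partner_head P) => [[H' [R' [S _]]]|[sH _]].
  by rewrite (split_not_mergeable _ _ S) in mg.
move: P; rewrite partnerE sH; case: ifP => // nmg.
case P: partner => [[up t2]|] // [eup et]; subst up s'.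
(* [H] cannot be merged with the new block. Either its second element fails the comparison with the
   maximum of [H], or its first element is below [M <= head 0 R], and then this element and
   [head 0 R] are two elements below that maximum. *)
have g2z : nth 0 (merge leq R F) 1 < last 0 H.
  rewrite ltn_neqAle; apply/andP; split.
    by apply: contraNneq zG => <-; apply: mem_nth; exact: ltnW.
  move: mg nmg r1G sz3 sG hR memG {P szG zG uRF zH bH}.
  move: (merge leq R F) => G; case: H {v u hH aH zn vR sH rkR hF} => [|x [|z []]] //=.
    by move=> _ + _; case: G => [|g1 [|g2 G]] //= + _ _ _ _; clear; lia.
  case: G => [|g1 [|g2 G]] //= /andP[Mr _] + r1G _ sG hR memG.
  case: (leqP M g1) => [Mg1 /=|g1M _]; first by clear; lia.
  have ne : head 0 R != g1 by rewrite neq_ltn (leq_trans g1M Mr) orbT.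
  apply: ltnW; apply: (@sorted_nth1_lt [:: g1, g2 & G] _ _ z sG r1G _ ne) => //.
    by rewrite inE eqxx.
  exact: leq_trans g1M (leq_trans Mr (ltnW hR)).
have [r er] := partner_head_small sz3 g2z P.
exists [:: nth 0 (merge leq R F) 1], r; rewrite er; split=> //.
by apply: leq_trans rkR => /=; move: zn g2z; clear; lia.
Qed.

(** The place where [t] merges into [s] is compared with the place where [t] is matched. If it is
    the same, [s = s0]; if it is earlier, [rank_merge_consumed] applies; if it is one block later,
    [rank_merge_remainder]; if it is still later, [s] would be matched downwards too. *)
Lemma alternating_rank n M t s0 s s' :
  valid M t -> M <= n -> all (ltn^~ n) (flatten t) ->
  partner M t = Some (false, s0) -> merged s t -> s <> s0 ->
  partner M s = Some (true, s') ->
  lex_lt (block_ranks n M s') (block_ranks n M t).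
Proof.
move=> + + + + mst; elim: mst M s0 s' => [E F q|B {}s {}t mst IH] M s0 s'.
  move=> v Mn al pt ne ps.
  have [bE hE vr u] := valid_cons v.
  have [bF hF _ _] := valid_cons vr.
  have uEF : uniq (E ++ F) by move: u; rewrite /= catA cat_uniq => /andP[].
  move: pt; rewrite partnerE; case S: split_block => [[H R]|] //.
  case: ifP => mg; first by case=> e; case: ne.
  move=> _; have [G [r [-> lt]]] := rank_merge_consumed bE bF uEF hE Mn hF S mg ps.
  by rewrite /= lt.
move=> v Mn al pt ne ps.
have [bB hB vt u] := valid_cons v.
have /andP[aB at'] : all (ltn^~ n) B && all (ltn^~ n) (flatten t) by rewrite -all_cat.
have [s1 t1 tb] := merged_cons mst.
move: pt; rewrite partnerE; case S: split_block => [[H R]|] //.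
case: t IH mst v al vt u at' t1 tb S => [|F q] // IH mst v al vt u at' _ tb S.
have SF : split_block M B false = None by [].
case: ifP => mg.
  case=> es0; subst s0.
  case: q mst tb v ps ne mg {IH vt at' S al u} => [|F2 q] // mst _ v ps ne mg.
  inversion mst as [E' F' q' e1 [e2 e3 e4]|B' s2 t2 m2 e1 [e2 e3]]; subst.
    have [G [r [-> lt]]] := rank_merge_remainder v aB mg ps.
    by rewrite /= eqxx lt orbT.
  have [s20 _ _] := merged_cons m2.
  by move: ps; rewrite partnerE SF; case: (s2) s20 => // F' s3 _; rewrite mg.
case P: partner => [[up s0']|] // [eup es0]; subst up s0.
have ne' : s <> s0' by move=> e; apply: ne; rewrite e.
have [bF hF _ _] := valid_cons vt.
have zn : last 0 B <= n.
  case/andP: bB aB => B0 _ /allP aB; apply: ltnW; apply: aB.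
  by case: (B) B0 => //= b B' _; exact: mem_last.
move: ps; rewrite partnerE; have -> : nilp s = false by case: (s) s1.
rewrite SF; case: s IH mst ne s1 ne' => // F' s IH mst ne _ ne'.
case: ifP => // _; case P': partner => [[up s'']|] // [eup es']; subst up s'.
by rewrite /= eqxx (IH _ _ _ vt zn at' P ne' P') orbT.
Qed.

(** * Matchings given by a partner function *)

Definition down_closed (V : finType) (K : {set {set V}}) : Prop :=
  forall s t : {set V}, t \in K -> s \subset t -> s \in K.

(** For [x] in [t] but not in [s], the face [x |: s] lies between the two, so a cover adds a single
    vertex. *)
Lemma coversE (V : finType) (K : {set {set V}}) (s t : {set V}) :
  down_closed K ->
  covers K s t = [&& t \in K, s \subset t & #|t| == #|s|.+1].
Proof.
move=> dK; apply/idP/idP => [/and4P[sK tK st /forall_inP nb]|/and3P[tK st /eqP ct]].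
  have [_ [x xt xs]] := properP st.
  have xst : x |: s \subset t by rewrite subUset sub1set xt (proper_sub st).
  have := nb _ (dK _ _ tK xst); rewrite properUr ?sub1set //= => nt.
  have et : t = x |: s.
    apply/eqP; rewrite eqEsubset xst andbT; apply: contraNT nt => nt.
    by rewrite properE xst.
  by rewrite tK (proper_sub st) et cardsU1 xs /=.
apply/and4P; split=> //; first exact: dK tK st.
  by rewrite properEcard st ct /=.
apply/forall_inP => r _; apply/negP => /andP[/proper_card sr /proper_card].
by rewrite ct ltnS leqNgt sr.
Qed.

Lemma path_lex_lt (T : eqType) (e : rel T) (f : T -> seq nat) (x : T) (p : seq T) :
  (forall y z, e y z -> lex_lt (f z) (f y)) -> path.path e x p -> p != [::] ->
  lex_lt (f (last x p)) (f x).
Proof.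
move=> H; elim: p x => //= y p IH x /andP[exy py] _.
case: p IH py => [_ _|z p IH py]; first exact: H.
exact: lex_lt_trans (IH _ py isT) (H _ _ exy).
Qed.

Lemma acyclic_of_rank (T : eqType) (e : rel T) (f : T -> seq nat) (c : seq T) :
  (forall y z, e y z -> lex_lt (f z) (f y)) -> path.cycle e c -> c = [::].
Proof.
case: c => //= x p H pc; have := path_lex_lt H pc.
by rewrite last_rcons lex_lt_irr -size_eq0 size_rcons => /(_ isT).
Qed.

Section partner_matching.
Variables (V : finType) (K : {set {set V}}).
Variables (mu : {set V} -> option (bool * {set V})) (rk : {set V} -> seq nat).
Hypothesis dK : down_closed K.
Hypothesis mu_up : forall s t, s \in K -> mu s = Some (true, t) ->
  covers K s t /\ mu t = Some (false, s).
Hypothesis mu_down : forall s t, t \in K -> mu t = Some (false, s) ->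
  covers K s t /\ mu s = Some (true, t).
Hypothesis rk_alt : forall t s0 s t', t \in K -> mu t = Some (false, s0) ->
  covers K s t -> s <> s0 -> mu s = Some (true, t') -> lex_lt (rk t') (rk t).

Definition partner_matching : {set {set {set V}}} :=
  [set e in powerset K | [exists s in K, exists t, (mu s == Some (true, t)) && (e == [set s; t])]].

Lemma partner_matchingP (e : {set {set V}}) :
  reflect (exists s t, [/\ s \in K, mu s = Some (true, t) & e = [set s; t]])
    (e \in partner_matching).
Proof.
rewrite inE; apply: (iffP andP) => [[_ /exists_inP[s sK /existsP[t /andP[/eqP m /eqP e_]]]]|].
  by exists s, t.
move=> [s [t [sK m ->]]]; split.
  have [/and4P[_ tK _ _] _] := mu_up sK m.
  by rewrite powersetE subUset !sub1set sK tK.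
by apply/exists_inP; exists s => //; apply/existsP; exists t; rewrite m !eqxx.
Qed.

Lemma covers_irr (s t : {set V}) : covers K s t -> covers K t s -> False.
Proof.
by move=> /and4P[_ _ /proper_card st _] /and4P[_ _ /proper_card /(ltn_trans st)]; rewrite ltnn.
Qed.

Lemma partner_matching_pair (s t : {set V}) : s \in K -> t \in K -> covers K s t ->
  ([set s; t] \in partner_matching) = (mu s == Some (true, t)).
Proof.
move=> sK tK cst; apply/partner_matchingP/eqP => [[s1 [t1 [s1K m e]]]|m]; last by exists s, t.
have [c1 _] := mu_up s1K m.
have : s \in [set s1; t1] by rewrite -e !inE eqxx.
have : t \in [set s1; t1] by rewrite -e !inE eqxx orbT.
have nst : s != t by case/and4P: cst => _ _ /proper_neq.
rewrite !inE => /orP[] /eqP et /orP[] /eqP es; subst s t => //.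
- by rewrite eqxx in nst.
- by case: (covers_irr c1).
- by rewrite eqxx in nst.
Qed.

Lemma partner_matching_is_matching : is_matching K partner_matching.
Proof.
apply/andP; split.
  apply/trivIsetP => e1 e2 /partner_matchingP[s1 [t1 [s1K m1 ->]]].
  move=> /partner_matchingP[s2 [t2 [s2K m2 ->]]] ne.
  have [_ m1'] := mu_up s1K m1; have [_ m2'] := mu_up s2K m2.
  rewrite -setI_eq0; apply: contraNT ne => /set0Pn[x].
  rewrite !inE => /andP[/orP[]/eqP-> /orP[]/eqP e]; subst.
  - by move: m2; rewrite -?e m1 => -[->].
  - by move: m2'; rewrite -?e m1.
  - by move: m2; rewrite -?e m1'.
  - by move: m2'; rewrite -?e m1' => -[->].
apply/forall_inP => e /partner_matchingP[s [t [sK m ->]]].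
apply/existsP; exists s; apply/existsP; exists t; rewrite eqxx andbT.
by have [] := mu_up sK m.
Qed.

Definition is_top (s : {set V}) : bool := if mu s is Some (false, _) then true else false.

(* Non-increasing along every arc in the first entry; the remaining entries
   rank the upper end of the pair of [s], and break the tie inside a pair. *)
Definition face_rank (s : {set V}) : seq nat :=
  (#|s| - is_top s) ::
  (match mu s with
   | Some (true, t) => 1 :: rk t ++ [:: 1]
   | Some (false, _) => 1 :: rk s ++ [:: 0]
   | None => [:: 0]
   end)%N.

Lemma lex_lt_cat a b c d : lex_lt a b -> lex_lt (a ++ c) (b ++ d).
Proof.
elim: a b => [|x a IH] [|y b] //= /orP[->//|/andP[-> /IH->]].
by rewrite orbT.
Qed.

Lemma lex_lt_catl a c d : lex_lt (a ++ c) (a ++ d) = lex_lt c d.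
Proof. by elim: a => //= x a ->; rewrite ltnn eqxx. Qed.

(** Along a downward arc from [x] to [y] the first entry stays equal only if [x] is an upper end and
    [y] is not. Then either [rk_alt] applies, or [y] is critical and its tail [[:: 0]] is below any
    tail starting with 1. *)
Lemma partner_matching_acyclic : acyclic_matching K partner_matching.
Proof.
split; first exact: partner_matching_is_matching.
move=> c; apply: (@acyclic_of_rank _ _ face_rank) => x y /orP[] /andP[cxy].
  have /and4P[xK yK _ _] := cxy.
  rewrite partner_matching_pair // => /eqP m; have [_ m'] := mu_up xK m.
  move: cxy; rewrite coversE // => /and3P[_ _ /eqP cy].
  rewrite /face_rank /is_top m m' /= cy subn0 subSS subn0 ltnn eqxx /=.
  by rewrite lex_lt_catl.
have /and4P[yK xK _ _] := cxy.
have := cxy; rewrite coversE // => /and3P[_ _ /eqP cx].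
have -> : [set x; y] = [set y; x] by rewrite setUC.
rewrite partner_matching_pair // => nm.
rewrite /face_rank /is_top cx; case mx: (mu x) => [[[] z]|] /=;
  try by case: (mu y) => [[[] w]|] /=; rewrite !subn0 ?subn1 /= ltnS ?leq_pred ?leqnn.
case my: (mu y) => [[[] w]|] /=; rewrite ?subn0 ?subn1 /= ?subn1.
- rewrite eqxx ltnn /= lex_lt_cat ?orbT //; apply: (rk_alt xK mx cxy _ my).
  by move=> eyz; have [_] := mu_down xK mx; rewrite -eyz => e; rewrite e eqxx in nm.
- have [/and4P[_ _ /proper_card wy _] _] := mu_down yK my.
  by rewrite ltn_predL (leq_ltn_trans _ wy).
- by rewrite eqxx orbT.
Qed.

Lemma partner_matching_unmatched (s : {set V}) : s \in K :\: cover partner_matching -> mu s = None.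
Proof.
rewrite inE => /andP[+ sK]; case m: (mu s) => [[[] t]|] //; case/negP.
  apply/bigcupP; exists [set s; t]; last by rewrite !inE eqxx.
  by apply/partner_matchingP; exists s, t.
have [/and4P[tK _ _ _] m'] := mu_down sK m.
apply/bigcupP; exists [set t; s]; last by rewrite !inE eqxx orbT.
by apply/partner_matchingP; exists t, s.
Qed.
End partner_matching.

(** * Faces of the h-complex as block lists *)

Definition elts (n : nat) (l : seq nat) : {set 'I_n} := [set x : 'I_n | val x \in l].

Lemma elts_cat n l1 l2 : elts n (l1 ++ l2) = elts n l1 :|: elts n l2.
Proof. by apply/setP => x; rewrite !inE mem_cat. Qed.

Lemma elts_eq_mem n l1 l2 : l1 =i l2 -> elts n l1 = elts n l2.
Proof. by move=> e; apply/setP => x; rewrite !inE e. Qed.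

Lemma elts_inj n l1 l2 : sorted ltn l1 -> sorted ltn l2 -> all (ltn^~ n) l1 ->
  all (ltn^~ n) l2 -> elts n l1 = elts n l2 -> l1 = l2.
Proof.
move=> s1 s2 /allP a1 /allP a2 e; apply: (irr_sorted_eq ltn_trans ltnn) => // x.
have H y (ly : y < n) : (y \in l1) = (y \in l2).
  by have := congr1 (fun A : {set 'I_n} => Ordinal ly \in A) e; rewrite !inE.
by apply/idP/idP => xl; [rewrite -H // | rewrite H //]; [exact: a1|exact: a2].
Qed.

(** [A] accumulates the earlier blocks. The union of all blocks is left out, since [n] itself does
    not belong to the chains. *)
Fixpoint prefixes (n : nat) (A : {set 'I_n}) (bs : seq (seq nat)) : seq {set 'I_n} :=
  if bs is B :: r then
    if nilp r then [::] else (A :|: elts n B) :: prefixes (A :|: elts n B) r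
  else [::].

Definition chain (n : nat) (bs : seq (seq nat)) : {set {set 'I_n}} :=
  [set S in prefixes set0 bs].

Lemma size_prefixes n (A : {set 'I_n}) bs : size (prefixes A bs) = (size bs).-1.
Proof. by elim: bs A => //= B [|F r] IH A //=; rewrite IH. Qed.

Lemma merged_prefixes n (A : {set 'I_n}) s t : merged s t ->
  exists p a q, prefixes A t = p ++ a :: q /\ prefixes A s = p ++ q.
Proof.
move=> m; elim: m A => [E F q|B {}s {}t m IH] A.
  exists [::], (A :|: elts n E), (prefixes (A :|: elts n E) (F :: q)); split => //=.
  have -> : elts n (merge leq E F) = elts n E :|: elts n F.
    by rewrite -elts_cat; apply: elts_eq_mem => x; rewrite mem_merge.
  by rewrite setUA.
have [s0 t0 _] := merged_cons m; have [p [a [q [et es]]]] := IH (A :|: elts n B).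
exists ((A :|: elts n B) :: p), a, q; rewrite /= et es.
by case: (s) (t) s0 t0 => [|? ?] [|? ?].
Qed.

(** Dropping the union that ends with a block amounts to merging this block with the next one; so
    every facet of a chain comes from a merge. *)
Lemma prefixes_merged n (A : {set 'I_n}) t p a q : prefixes A t = p ++ a :: q ->
  exists2 s, merged s t & prefixes A s = p ++ q.
Proof.
elim: t A p => [|B [|F r] IH] A p; [by case: p..|].
case: p => [|a' p] /= [ea er].
  exists (merge leq B F :: r); first by constructor.
  rewrite -er /=; have -> : elts n (merge leq B F) = elts n B :|: elts n F.
    by rewrite -elts_cat; apply: elts_eq_mem => x; rewrite mem_merge.
  by rewrite setUA.
have [s m es] := IH _ p er.
exists (B :: s); first by constructor.
by have [s0 _ _] := merged_cons m; case: s s0 es {m} => //= ? ? _ ->; rewrite ea.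
Qed.

Definition full (n : nat) (bs : seq (seq nat)) : bool :=
  [&& valid n bs, all (ltn^~ n) (flatten bs) & size (flatten bs) == n].

Lemma full_merged n s t : merged s t -> full n t -> full n s.
Proof.
move=> m /and3P[v a sz]; have pe := merged_flatten m.
by rewrite /full (merged_valid m v) (perm_all _ pe) a (perm_size pe).
Qed.

Definition blocks_off (n : nat) (A : {set 'I_n}) (bs : seq (seq nat)) : bool :=
  [&& all blockb bs, uniq (flatten bs), all (ltn^~ n) (flatten bs)
    & [disjoint A & elts n (flatten bs)]].

Lemma blocks_off_cons n (A : {set 'I_n}) B r : blocks_off A (B :: r) ->
  [/\ blockb B, all (ltn^~ n) B, [disjoint A & elts n B] & blocks_off (A :|: elts n B) r].
Proof.
rewrite /blocks_off /= cat_uniq all_cat elts_cat.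
move=> /and4P[/andP[-> ->] /and3P[_ /hasPn nB ->] /andP[-> ->]].
rewrite -!setI_eq0 setIUr setU_eq0 => /andP[-> AR] /=; split=> //.
rewrite setIUl setU_eq0 AR /=; apply/eqP/setP => x; rewrite !inE.
by apply/negP => /andP[xB /nB /=]; rewrite xB.
Qed.

Lemma full_blocks_off n bs : full n bs -> blocks_off (set0 : {set 'I_n}) bs.
Proof.
move=> /and3P[/and3P[b u _] a _]; rewrite /blocks_off b u a /=.
by rewrite -setI_eq0 set0I.
Qed.

Lemma prefixes_path n (A : {set 'I_n}) bs : blocks_off A bs ->
  path (fun X Y : {set 'I_n} => X \proper Y) A (prefixes A bs).
Proof.
elim: bs A => // B [|F r] IH A //= /blocks_off_cons[/andP[B0 _] aB dA /IH /= ->].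
rewrite andbT properE subsetUl /=; case: B B0 aB dA => //= b B _ /andP[bn _].
rewrite -setI_eq0 => /eqP d; apply/negP => /subsetP/(_ (Ordinal bn)).
rewrite !inE /= eqxx orbT => /(_ isT) bA.
by have := in_set0 (Ordinal bn); rewrite -d !inE bA /= eqxx.
Qed.

(** Each block is the difference of two consecutive unions; the last one is recovered from the
    common total. Disjointness from [A] permits cancelling it. *)
Lemma prefixes_inj n (A : {set 'I_n}) bs bs' : blocks_off A bs -> blocks_off A bs' ->
  elts n (flatten bs) = elts n (flatten bs') -> (bs == [::]) = (bs' == [::]) ->
  prefixes A bs = prefixes A bs' -> bs = bs'.
Proof.
elim: bs A bs' => [|B r IH] A [|B' r'] //.
move=> /blocks_off_cons[bB aB dB bo] /blocks_off_cons[bB' aB' dB' bo'] e _ pe.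
have sr : nilp r = nilp r'.
  by move: pe => /=; case: (r) => [|? ?] //=; case: (r') => [|? ?] //=.
have U (X Y : {set 'I_n}) : [disjoint A & X] -> [disjoint A & Y] -> A :|: X = A :|: Y -> X = Y.
  rewrite -!setI_eq0 => /eqP AX /eqP AY eXY; apply/setP => x.
  have := congr1 (fun Z : {set 'I_n} => x \in Z) eXY.
  have := congr1 (fun Z : {set 'I_n} => x \in Z) AX.
  have := congr1 (fun Z : {set 'I_n} => x \in Z) AY.
  by rewrite !inE; case: (x \in A) => /= [-> ->|].  
have eB : B = B'.
  apply: (@elts_inj n) => //; [by case/andP: bB|by case/andP: bB'|].
  move: pe e sr => /=; case: r r' {IH bo bo'} => [|F r] [|F' r'] //=.
    by rewrite !cats0.
  by move=> [+ _] _ _; exact: U.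
rewrite -{}eB in bo' dB' pe e *; congr (_ :: _); apply: (IH _ _ bo bo').
- have dis r1 : blocks_off (A :|: elts n B) r1 ->
      elts n (flatten r1) = elts n (B ++ flatten r1) :\: elts n B.
    case/and4P=> _ _ _; rewrite elts_cat -setI_eq0 => /eqP d.
    apply/setP => x; have := congr1 (fun Z : {set 'I_n} => x \in Z) d.
    by rewrite !inE; case: (val x \in B) => //=; rewrite orbT.
  by rewrite (dis _ bo) (dis _ bo') e.
- by move: sr; rewrite /nilp !size_eq0.
- by move: pe sr => /=; case: (r) => [|F r1]; case: (r') => [|F' r1'] //= [].
Qed.

Lemma full_elts n bs : full n bs -> elts n (flatten bs) = setT.
Proof.
move=> /and3P[/and3P[_ u _] a /eqP sz].
apply/setP => x; rewrite !inE.
have sub : {subset flatten bs <= iota 0 n}.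
  by move=> y /(allP a) yn; rewrite mem_iota.
have [|_ ->] := uniq_min_size u sub; first by rewrite size_iota sz.
by rewrite mem_iota add0n ltn_ord.
Qed.

(** Strict inclusion orders a chain in only one way, so the set of prefixes determines their
    list. *)
Lemma chain_inj n bs bs' : 0 < n -> full n bs -> full n bs' ->
  chain n bs = chain n bs' -> bs = bs'.
Proof.
move=> n0 fb fb' e.
have nn bs1 : full n bs1 -> (bs1 == [::]) = false.
  by case: bs1 => //= /and3P[_ _]; rewrite eq_sym -leqn0 leqNgt n0.
apply: (@prefixes_inj n set0); rewrite ?full_blocks_off ?full_elts ?nn //.
have st bs1 : full n bs1 -> sorted (fun X Y : {set 'I_n} => X \proper Y) (prefixes set0 bs1).
  by move=> /full_blocks_off/prefixes_path/path_sorted.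
apply: (irr_sorted_eq _ _ (st _ fb) (st _ fb')).
- by move=> X Y Z; exact: proper_trans.
- by move=> X; rewrite properxx.
- by move=> X; have := congr1 (fun Z : {set _} => X \in Z) e; rewrite !inE.
Qed.

Lemma prefixes_uniq n bs : full n bs -> uniq (prefixes (set0 : {set 'I_n}) bs).
Proof.
move=> /full_blocks_off/prefixes_path/path_sorted.
apply: sorted_uniq; first by move=> X Y Z; exact: proper_trans.
by move=> X; rewrite properxx.
Qed.

Lemma card_chain n bs : full n bs -> #|chain n bs| = (size bs).-1.
Proof.
by move=> fb; rewrite cardsE (card_uniqP (prefixes_uniq fb)) size_prefixes.
Qed.

(** * Descents of a word and its ascending runs *)

Fixpoint descents (n : nat) (A : {set 'I_n}) (w : seq nat) : seq {set 'I_n} :=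
  if w is x :: w' then
    if w' is y :: _ then
      if y < x then (A :|: elts n [:: x]) :: descents (A :|: elts n [:: x]) w'
      else descents (A :|: elts n [:: x]) w'
    else [::]
  else [::].

Lemma elts_cons n x l : elts n (x :: l) = elts n [:: x] :|: elts n l.
Proof. exact: (elts_cat n [:: x]). Qed.

Lemma descents_cons2 n (A : {set 'I_n}) x y w : descents A [:: x, y & w] =
  if y < x then (A :|: elts n [:: x]) :: descents (A :|: elts n [:: x]) (y :: w)
  else descents (A :|: elts n [:: x]) (y :: w).
Proof. by []. Qed.

(** Blocks increase, and by [valid] the head of a block is below the last element of the previous
    one: descents occur exactly between blocks. *)
Lemma descents_flatten n (A : {set 'I_n}) M bs : valid M bs ->
  descents A (flatten bs) = prefixes A bs.
Proof.
elim: bs A M => // B r IH A M /valid_cons[/andP[B0 sB] _ vr _].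
case: B B0 sB vr => // b B _ /= + vr; elim: B b A vr => [|b' B IHB] b A vr p.
  case: r IH vr => // F r IH vr.
  have [/andP[F0 _] hF _ _] := valid_cons vr.
  rewrite [prefixes _ _]/= -[if nilp r then _ else _]/(prefixes _ (F :: r)) -(IH _ _ vr).
  case: F F0 hF {IH vr} => // f F _ fb.
  by apply: (etrans (descents_cons2 A b f (F ++ flatten r))); rewrite (fb : f < b).
move: p => /= /andP[bb' p].
have := IHB b' (A :|: elts n [:: b]) vr p.
move=> e; apply: (etrans (descents_cons2 A b b' (B ++ flatten r))).
rewrite ltnNge (ltnW bb'); apply: (etrans e) => /=.
by rewrite -setUA -elts_cons.
Qed.

Lemma mem_descents n (A S : {set 'I_n}) w : reflect
  (exists i, [/\ i.+1 < size w, nth 0 w i.+1 < nth 0 w i & S = A :|: elts n (take i.+1 w)])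
  (S \in descents A w).
Proof.
elim: w A => [|x [|y w] IH] A; [by apply: (iffP idP) => // -[i []]..|].
have rec : reflect (exists i, [/\ i.+2 < size [:: x, y & w],
      nth 0 [:: x, y & w] i.+2 < nth 0 [:: x, y & w] i.+1
      & S = A :|: elts n (take i.+2 [:: x, y & w])])
    (S \in descents (A :|: elts n [:: x]) (y :: w)).
  apply: (iffP (IH _)) => -[i [si ni ->]]; exists i; split=> //.
    by rewrite -setUA -elts_cons.
  by rewrite -setUA -elts_cons.
rewrite [descents _ _]/=; case: ifP => yx.
  rewrite inE; apply: (iffP orP) => [[/eqP->|/rec[i H]]|[[|i]]].
  - by exists 0.
  - by exists i.+1.
  - by case=> _ _ ->; left; apply/eqP.
  - by move=> H; right; apply/rec; exists i.
apply: (iffP rec) => [[i H]|[[|i] H]]; [by exists i.+1| |by exists i].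
by case: H; rewrite /= yx.
Qed.

Definition word (n : nat) (p : 'S_n) : seq nat := [seq val (p i) | i <- enum 'I_n].

Lemma size_word n (p : 'S_n) : size (word p) = n.
Proof. by rewrite size_map size_enum_ord. Qed.

Lemma nth_word n (p : 'S_n) (i : 'I_n) : nth 0 (word p) i = p i.
Proof. by rewrite (nth_map i) ?size_enum_ord // nth_ord_enum. Qed.

Lemma elts_take_word n (p : 'S_n) (i : nat) :
  elts n (take i.+1 (word p)) = p @: [set k : 'I_n | k <= i].
Proof.
apply/setP => x; rewrite inE; apply/idP/imsetP => [|[k]].
  move=> /(nthP 0)[j]; rewrite size_take_min size_word leq_min => /andP[ji jn].
  rewrite nth_take // => e; exists (Ordinal jn); first by rewrite inE.
  by apply: val_inj; rewrite -e (nth_word p (Ordinal jn)).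
rewrite inE => ki ->; apply/(nthP 0); exists k.
  by rewrite size_take_min size_word leq_min ltnS ki ltn_ord.
by rewrite nth_take // nth_word.
Qed.

Lemma descent_chainE n (p : 'S_n) : descent_chain p = [set S in descents set0 (word p)].
Proof.
apply/setP => S; rewrite inE; apply/imsetP/mem_descents => [[i]|[i [si ni ->]]].
  rewrite inE => /existsP[j /andP[/eqP ji pji]] ->; exists i.
  rewrite -ji !nth_word size_word ltn_ord; split=> //.
  by rewrite set0U ji elts_take_word.
rewrite size_word in si; have i_n := ltnW si.
exists (Ordinal i_n); last by rewrite set0U elts_take_word.
rewrite inE; apply/existsP; exists (Ordinal si); rewrite eqxx /=.
by move: ni; rewrite (nth_word p (Ordinal i_n)) (nth_word p (Ordinal si)).
Qed.

(** The word is cut at its descents, from the right end to the left. *)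
Lemma ascending_runs (M : nat) w : uniq w -> w != [::] -> head 0 w < M ->
  exists2 bs, valid M bs & flatten bs = w.
Proof.
elim: w M => // x [|y w] IH M u _ xM.
  by exists [:: [:: x]] => //; rewrite /valid /= xM.
have /andP[xw u'] := u; case: (ltnP x y) => xy.
  (* The bound [y.+1] is a harmless choice: [x] is prepended to the first run, and the head
     condition becomes one on [x]. *)
  have [bs v e] := IH y.+1 u' isT (ltnSn y).
  case: bs v e => [_|B0 r] //; case: B0 => [|z B] v; first by case/valid_cons: v => /andP[].
  move=> [ez e]; subst z; have [/andP[_ p] _ vr _] := valid_cons v.
  exists ((x :: y :: B) :: r); last by rewrite /= e.
  by apply: valid_consI => //=; [rewrite /blockb /= xy | rewrite -e in u].
have yx : y < x.
  by rewrite ltn_neqAle xy andbT; apply: contraNneq xw => <-; rewrite inE eqxx.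
have [bs v e] := IH x u' isT yx.
exists ([:: x] :: bs); last by rewrite /= e.
by apply: valid_consI => //=; rewrite e.
Qed.

(** The blocks of a face are the ascending runs of the permutation; conversely the concatenated
    blocks are the word of a permutation with these descents. *)
Lemma h_complexP n (s : {set {set 'I_n}}) : 0 < n ->
  reflect (exists2 bs, full n bs & s = chain n bs) (s \in h_complex n).
Proof.
move=> n0; apply: (iffP imsetP) => [[p _ ->]|[bs fb ->]].
  have pn x : x \in word p -> x < n by move=> /mapP[i _ ->]; exact: ltn_ord.
  have [||| bs v e] := @ascending_runs n (word p).
  - by rewrite /word map_inj_uniq ?enum_uniq // => i j /val_inj/perm_inj.
  - by rewrite -size_eq0 size_word -lt0n.
  - apply: pn; case: (word p) (size_word p) => [e|x w _].
      by move: n0; rewrite -e.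
    by rewrite inE eqxx.
  exists bs; last by rewrite descent_chainE -e (descents_flatten _ v).
  by rewrite /full v e size_word eqxx andbT; apply/allP.
have /and3P[v a /eqP sz] := fb.
have lt (i : 'I_n) : nth 0 (flatten bs) i < n by apply: (allP a); rewrite mem_nth ?sz.
have inj : injective (fun i : 'I_n => Ordinal (lt i)).
  move=> i j [] e; apply/val_inj/eqP.
  have u : uniq (flatten bs) by case/and3P: v.
  have := @nth_uniq _ 0 _ i j _ _ u; rewrite sz !ltn_ord => /(_ isT isT) <-.
  by rewrite e.
exists (perm inj) => //; rewrite descent_chainE /chain -(descents_flatten _ v).
suff -> : word (perm inj) = flatten bs by [].
apply: (@eq_from_nth _ 0); rewrite size_word ?sz // => i lti.
by rewrite (nth_word _ (Ordinal lti)) permE.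
Qed.

Lemma chain_merged n s t : full n t -> merged s t ->
  exists2 a, a \in chain n t & chain n s = chain n t :\ a.
Proof.
move=> ft m; have [p [a [q [et es]]]] := @merged_prefixes n set0 _ _ m.
have := prefixes_uniq ft; rewrite et cat_uniq /= => /and3P[_ /norP[ap _] /andP[aq _]].
exists a; first by rewrite inE et mem_cat inE eqxx orbT.
apply/setP => x; rewrite !inE et es !mem_cat inE.
by case: eqP => // ->; rewrite (negbTE ap) (negbTE aq).
Qed.

Lemma chain_setD1 n t a : full n t -> a \in chain n t ->
  exists2 s, merged s t & chain n s = chain n t :\ a.
Proof.
move=> ft; rewrite inE => /splitPr et.
have [p [q e]] : exists p q, prefixes set0 t = p ++ a :: q by case: et => p q; exists p, q.
have [s m es] := prefixes_merged e; exists s => //.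
have := prefixes_uniq ft; rewrite e cat_uniq /= => /and3P[_ /norP[ap _] /andP[aq _]].
apply/setP => x; rewrite !inE e es !mem_cat inE.
by case: eqP => // ->; rewrite (negbTE ap) (negbTE aq).
Qed.

(** The members of the chain outside [s] are removed one by one; each removal is a merge and
    preserves [full]. *)
Lemma h_complex_down n : 0 < n -> down_closed (h_complex n).
Proof.
move=> n0 s t /(h_complexP _ n0)[bs fb ->].
have [k] := ubnP #|chain n bs :\: s|; elim: k bs fb => // k IH bs fb lk st.
case: (set_0Vmem (chain n bs :\: s)) => [/eqP|[a]].
  rewrite setD_eq0 => ts; apply/(h_complexP _ n0); exists bs => //.
  by apply/eqP; rewrite eqEsubset st.
rewrite inE => /andP[as_ at_].
have [bs' m e] := chain_setD1 fb at_.
apply: (IH bs'); first exact: full_merged m fb.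
  rewrite e -ltnS; apply: leq_trans lk; rewrite ltnS; apply: proper_card.
  apply/properP; split; first by apply: setSD; rewrite subD1set.
  by exists a; rewrite in_setD ?in_setD1 ?eqxx ?andbF // as_.
by rewrite e subsetD1 st.
Qed.

(** * The matching on the h-complex *)

Lemma covers_merged n s t : 0 < n -> full n s -> full n t ->
  covers (h_complex n) (chain n s) (chain n t) <-> merged s t.
Proof.
move=> n0 fs ft; rewrite coversE; last exact: h_complex_down.
split=> [/and3P[_ st /eqP c]|m].
  have [a at_ as_] : exists2 a, a \in chain n t & a \notin chain n s.
    have : chain n s \proper chain n t by rewrite properEcard st c /=.
    by case/properP.
  have [s' m e] := chain_setD1 ft at_.
  suff -> : s = s' by [].
  apply: (chain_inj n0 fs (full_merged m ft)); rewrite e.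
  apply/eqP; rewrite eqEcard subsetD1 st as_ /=.
  by rewrite -ltnS -c (cardsD1 a (chain n t)) at_.
have [a at_ ->] := chain_merged ft m.
rewrite subD1set (cardsD1 a (chain n t)) at_ eqxx !andbT.
by apply/(h_complexP _ n0); exists t.
Qed.

Lemma full_of_merged n s t : merged s t -> full n s -> valid n t -> full n t.
Proof.
move=> m /and3P[_ a sz] v; have pe := merged_flatten m.
by rewrite /full v -(perm_all _ pe) a -(perm_size pe).
Qed.

(** [partner n] is transported along the bijection between block lists and faces. A face with k
    blocks has k - 1 elements, so [partner_none] becomes the stated bound. *)
Lemma h_complex_matching n : 0 < n ->
  exists M : {set {set {set {set 'I_n}}}}, acyclic_matching (h_complex n) M /\
    forall s, s \in h_complex n :\: cover M -> n <= 3 * #|s| + 1.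
Proof.
move=> n0; set K := h_complex n.
(* [f] chooses the block list of a face; off [K] it takes the default value [[::]]. *)
have [f fP] : exists f : {set {set 'I_n}} -> seq (seq nat),
    forall s, s \in K -> full n (f s) /\ s = chain n (f s).
  apply: (@fin_all_exists _ (fun=> seq (seq nat))
    (fun s bs => s \in K -> full n bs /\ s = chain n bs)) => s.
  case: (boolP (s \in K)) => [/(h_complexP _ n0)[bs fb e]|_]; last by exists [::].
  by exists bs.
have chK bs : full n bs -> chain n bs \in K by move=> fb; apply/(h_complexP _ n0); exists bs.
have fK bs : full n bs -> f (chain n bs) = bs.
  move=> fb; have [fb' e] := fP _ (chK _ fb).
  exact/esym/(chain_inj n0 fb fb').
have fne bs : full n bs -> bs != [::].
  by case: bs => //= /and3P[_ _]; rewrite eq_sym -leqn0 leqNgt n0.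
pose mu s := if partner n (f s) is Some (u, bs) then Some (u, chain n bs) else None.
have muE s u t : mu s = Some (u, t) -> exists2 bs, partner n (f s) = Some (u, bs) & t = chain n bs.
  by rewrite /mu; case: partner => [[u' bs]|] // [-> <-]; exists bs.
have mu_up s t : s \in K -> mu s = Some (true, t) -> covers K s t /\ mu t = Some (false, s).
  move=> /fP[fs es] /muE[bs p ->]; have /and3P[vs _ _] := fs.
  have [v m p'] := partner_up vs p; have fb := full_of_merged m fs v.
  by rewrite /mu fK // p' -es {1}es; split=> //; apply/covers_merged.
have mu_down s t : t \in K -> mu t = Some (false, s) -> covers K s t /\ mu s = Some (true, t).
  move=> /fP[ft et] /muE[bs p ->]; have /and3P[vt _ _] := ft.
  have [m p'] := partner_down vt p; have fb := full_merged m ft.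
  by rewrite /mu fK // p' -et {1}et; split=> //; apply/covers_merged.
pose rk s := block_ranks n n (f s).
have rk_alt t s0 s t' : t \in K -> mu t = Some (false, s0) -> covers K s t ->
    s <> s0 -> mu s = Some (true, t') -> lex_lt (rk t') (rk t).
  move=> tK mt; have [ft et] := fP _ tK => cst ne ms.
  have sK : s \in K by case/and4P: cst.
  have [fs es] := fP _ sK; have /and3P[vt at_ _] := ft; have /and3P[vs _ _] := fs.
  have [bs0 p0 e0] := muE _ _ _ mt; have [bs p e] := muE _ _ _ ms.
  have [v m p'] := partner_up vs p; have fb := full_of_merged m fs v.
  rewrite /rk e fK //; apply: (alternating_rank vt (leqnn n) at_ p0 _ _ p).
    by apply/(covers_merged n0 fs ft); rewrite -es -et.
  by move=> e'; apply: ne; rewrite es e' -e0.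
have dK := h_complex_down n0.
exists (partner_matching K mu); split.
  exact: (partner_matching_acyclic dK mu_up mu_down rk_alt).
move=> s sU; have := partner_matching_unmatched mu_up mu_down sU.
move: sU; rewrite inE => /andP[_ sK]; have [fs es] := fP _ sK.
rewrite /mu; case p: partner => [[]|] // _.
have /and3P[vs as_ /eqP sz] := fs.
have := partner_none (fne _ fs) vs as_ p; rewrite sz [in #|s|]es (card_chain fs).
have : 0 < size (f s) by rewrite lt0n size_eq0 fne.
by move: (size (f s)) => k; clear; lia.
Qed.

From mathcomp Require Import all_classical all_reals all_analysis.
Import Order.TTheory GRing.Theory Num.Theory.
Import numFieldNormedType.Exports.
Local Open Scope classical_set_scope.
Local Open Scope ring_scope.

(** * Continuity on a subspace *)

Section within.
Variables (R : realType) (T : topologicalType) (A : set T).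
Implicit Types f g : T -> R.

Lemma withinc_cst (c : R) : {within A, continuous (fun=> c)}.
Proof. by move=> x; exact: cvg_cst. Qed.

Lemma withincD f g : {within A, continuous f} -> {within A, continuous g} ->
  {within A, continuous (fun x => f x + g x)}.
Proof. by move=> cf cg x; apply: cvgD; [exact: cf|exact: cg]. Qed.

Lemma withincB f g : {within A, continuous f} -> {within A, continuous g} ->
  {within A, continuous (fun x => f x - g x)}.
Proof. by move=> cf cg x; apply: cvgB; [exact: cf|exact: cg]. Qed.

Lemma withincM f g : {within A, continuous f} -> {within A, continuous g} ->
  {within A, continuous (fun x => f x * g x)}.
Proof. by move=> cf cg x; apply: cvgM; [exact: cf|exact: cg]. Qed.

Lemma withincV f : (forall x, A x -> f x != 0) -> {within A, continuous f} ->
  {within A, continuous (fun x => (f x)^-1)}.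
Proof.
move=> f0 /subspace_continuousP cf; apply/subspace_continuousP => x Ax.
by apply: cvgV; [exact: f0|exact: cf].
Qed.

Lemma withinc_max f g : {within A, continuous f} -> {within A, continuous g} ->
  {within A, continuous (fun x => Num.max (f x) (g x))}.
Proof. by move=> cf cg x; apply: (@continuous_max R (subspace A)); [exact: cf|exact: cg]. Qed.

Lemma withinc_min f g : {within A, continuous f} -> {within A, continuous g} ->
  {within A, continuous (fun x => Num.min (f x) (g x))}.
Proof. by move=> cf cg x; apply: (@continuous_min R (subspace A)); [exact: cf|exact: cg]. Qed.

Lemma withinc_sum (I : Type) (r : seq I) (P : pred I) (F : I -> T -> R) :
  (forall i, {within A, continuous (F i)}) ->
  {within A, continuous (fun x => \sum_(i <- r | P i) F i x)}.
Proof.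
move=> cF; elim: r => [|i r IH].
  by under eq_fun do rewrite big_nil; exact: withinc_cst.
under eq_fun do rewrite big_cons; case: (P i) => //.
exact: withincD.
Qed.

Lemma withinc_bigmax (I : Type) (r : seq I) (P : pred I) (F : I -> T -> R) (c : R) :
  (forall i, {within A, continuous (F i)}) ->
  {within A, continuous (fun x => \big[Num.max/c]_(i <- r | P i) F i x)}.
Proof.
move=> cF; elim: r => [|i r IH].
  by under eq_fun do rewrite big_nil; exact: withinc_cst.
under eq_fun do rewrite big_cons; case: (P i) => //.
exact: withinc_max.
Qed.

Lemma withinc_bigmin (I : Type) (r : seq I) (P : pred I) (F : I -> T -> R) (c : R) :
  (forall i, {within A, continuous (F i)}) ->
  {within A, continuous (fun x => \big[Num.min/c]_(i <- r | P i) F i x)}.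
Proof.
move=> cF; elim: r => [|i r IH].
  by under eq_fun do rewrite big_nil; exact: withinc_cst.
under eq_fun do rewrite big_cons; case: (P i) => //.
exact: withinc_min.
Qed.

(** As [h] maps a neighbourhood of [x] into [A], it tends to [h x] within [A]. *)
Lemma continuous_comp_within (U : topologicalType) (f : T -> R) (h : U -> T) (x : U) :
  {within A, continuous f} -> {for x, continuous h} -> A (h x) ->
  (\forall y \near x, A (h y)) -> {for x, continuous (f \o h)}.
Proof.
move=> /subspace_continuousP cf ch Ax Anear.
apply: (cvg_comp h f (G := within A (nbhs (h x)))); last exact: cf.
by move=> W nW; apply: filterS2 Anear (ch _ nW) => y Ay; apply.
Qed.

End within.

Lemma withinT_continuous (T U : topologicalType) (f : T -> U) :
  {within setT, continuous f} -> continuous f.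
Proof. by move=> cf x W /cf; rewrite nbhs_subspaceT. Qed.

Lemma ptws_withinP (R : realType) (T : topologicalType) (A : set T) (V : finType)
    (f : T -> {ptws V -> R}) :
  {within A, continuous f} <-> forall v, {within A, continuous (fun x => f x v)}.
Proof.
split=> [cf v x|cf].
  apply: (cvg_comp f (fun h : {ptws V -> R} => h v)); first exact: cf.
  exact: (@proj_continuous V (fun=> R) v (f x)).
move=> x; apply/cvg_sup => v W /= -[B [[C oC <-] Cfx] sub].
apply: (@filterS _ _ _ (f @^-1` ((fun h : {ptws V -> R} => h v) @^-1` C))).
  by move=> y /sub.
by apply: (cf v x); exact: open_nbhs_nbhs.
Qed.

(** * Extending maps from the sphere to the ball *)

Section enorm.
Variables (R : realType) (d : nat).
Implicit Types x : 'rV[R]_d.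

Definition enorm x : R := Num.sqrt (\sum_i x ord0 i ^+ 2).

Lemma sum_sqr_ge0 x : 0 <= \sum_i x ord0 i ^+ 2.
Proof. by apply: sumr_ge0 => i _; exact: sqr_ge0. Qed.

Lemma unit_sphereE x : unit_sphere R d x <-> enorm x = 1.
Proof.
rewrite /unit_sphere /enorm /=; split=> [->|e]; first exact: sqrtr1.
by rewrite -[LHS]sqr_sqrtr ?sum_sqr_ge0 // e expr1n.
Qed.

Lemma unit_ballE x : unit_ball R d x <-> enorm x <= 1.
Proof.
rewrite /unit_ball /enorm /=; split=> [h|h].
  by rewrite -sqrtr1 ler_sqrt.
by rewrite -(sqr_sqrtr (sum_sqr_ge0 x)) expr_le1 ?sqrtr_ge0.
Qed.

Lemma enormZ (c : R) x : 0 <= c -> enorm (c *: x) = c * enorm x.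
Proof.
move=> c0; rewrite /enorm -{2}(ger0_norm c0) -sqrtr_sqr -sqrtrM ?sqr_ge0 //.
by congr Num.sqrt; rewrite mulr_sumr; apply: eq_bigr => i _; rewrite mxE exprMn.
Qed.

Lemma enorm_continuous : continuous enorm.
Proof.
move=> x; apply: (@continuous_comp _ _ _ (fun y : 'rV[R]_d => \sum_i y ord0 i ^+ 2)).
  move: x; apply: withinT_continuous; apply: withinc_sum => i.
  have c : continuous (fun y : 'rV[R]_d => y ord0 i) := @coord_continuous R 1 d ord0 i.
  under eq_fun do rewrite expr2.
  by apply: withincM; apply: continuous_subspaceT => y; exact: c.
exact: sqrt_continuous.
Qed.

End enorm.

Section fills.
Variables (R : realType) (V : finType).
Implicit Types (K : {set {set V}}) (y : V -> R).

Definition supp y : {set V} := [set v | y v != 0]%SET.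

Lemma realization_segment K (s : {set V}) y y' (t : R) : down_closed K ->
  geometric_realization R K y -> geometric_realization R K y' ->
  s \in K -> supp y \subset s -> supp y' \subset s -> 0 <= t <= 1 ->
  geometric_realization R K (fun v => y' v + t * (y v - y' v)).
Proof.
move=> dK [y0 y1 _] [y'0 y'1 _] sK ys y's /andP[t0 t1]; split=> [v||].
- have -> : y' v + t * (y v - y' v) = (1 - t) * y' v + t * y v by lra.
  by apply: addr_ge0; apply: mulr_ge0 => //; rewrite subr_ge0.
- by rewrite big_split /= -mulr_sumr sumrB y1 y'1 subrr mulr0 addr0.
apply: dK sK _; apply/fintype.subsetP => v; rewrite inE => nz.
apply: contraNT nz => vs.
have y0v : y v = 0.
  by apply/eqP; apply: contraNT vs => h; apply: (fintype.subsetP ys); rewrite inE.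
have y0v' : y' v = 0.
  by apply/eqP; apply: contraNT vs => h; apply: (fintype.subsetP y's); rewrite inE.
by rewrite y0v y0v' subrr mulr0 addr0.
Qed.

(** This is the extension clause of [k_connected] in one dimension, stated coordinatewise so that
    only real-valued continuity has to be handled. *)
Definition fills (j : nat) K : Prop :=
  forall f : 'rV[R]_j.+1 -> V -> R,
    (forall v, {within unit_sphere R j.+1, continuous (fun x => f x v)}) ->
    (forall x, unit_sphere R j.+1 x -> geometric_realization R K (f x)) ->
    exists g : 'rV[R]_j.+1 -> V -> R,
      [/\ forall v, {within unit_ball R j.+1, continuous (fun x => g x v)},
          forall x, unit_ball R j.+1 x -> geometric_realization R K (g x)
        & forall x, unit_sphere R j.+1 x -> g x = f x].

(* [g] runs through the given filling of [f'] on the ball of radius 1/2 and along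
   the segments from [f'] to [f] on the collar. *)
Lemma fills_carried j K (L : {set {set V}}) (f f' : 'rV[R]_j.+1 -> V -> R) :
  down_closed K -> L \subset K -> fills j L ->
  (forall v, {within unit_sphere R j.+1, continuous (fun x => f x v)}) ->
  (forall v, {within unit_sphere R j.+1, continuous (fun x => f' x v)}) ->
  (forall x, unit_sphere R j.+1 x -> geometric_realization R K (f x)) ->
  (forall x, unit_sphere R j.+1 x -> geometric_realization R L (f' x)) ->
  (forall x, unit_sphere R j.+1 x -> exists s : {set V},
    [/\ s \in K, supp (f x) \subset s & supp (f' x) \subset s]) ->
  exists g : 'rV[R]_j.+1 -> V -> R,
    [/\ forall v, {within unit_ball R j.+1, continuous (fun x => g x v)},
        forall x, unit_ball R j.+1 x -> geometric_realization R K (g x)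
      & forall x, unit_sphere R j.+1 x -> g x = f x].
Proof.
move=> dK LK fL cf cf' Kf Lf' car; have [g' [cg' Lg' eg']] := fL _ cf' Lf'.
have LinK y : geometric_realization R L y -> geometric_realization R K y.
  by case=> h1 h2 h3; split=> //; exact: (fintype.subsetP LK).
pose N (x : 'rV[R]_j.+1) := enorm x.
(* [rho] doubles [x] up to radius 1/2 and agrees with the radial projection [nu] beyond; [sc] grows
   from 0 at radius 1/2 to 1 on the sphere. Near the origin, where [nu] is not continuous, [sc]
   vanishes. *)
pose rho (x : 'rV[R]_j.+1) := (2 / Num.max 1 (2 * N x)) *: x.
pose sc x := Num.max 0 (2 * N x - 1).
pose nu (x : 'rV[R]_j.+1) := (N x)^-1 *: x.
have max_gt0 x : 0 < Num.max 1 (2 * N x) :> R by rewrite lt_max ltr01.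
have rhoB x : unit_ball R j.+1 (rho x).
  apply/unit_ballE; rewrite enormZ ?divr_ge0 ?(ltW (max_gt0 x)) //.
  by rewrite mulrAC ler_pdivrMr // mul1r le_max lexx orbT.
have nuS x : 0 < N x -> unit_sphere R j.+1 (nu x).
  move=> Nx; apply/unit_sphereE; rewrite enormZ ?invr_ge0 ?(ltW Nx) //.
  by rewrite mulVf // gt_eqF.
have cN : continuous N := @enorm_continuous R j.+1.
have wN : {within [set: 'rV[R]_j.+1], continuous N} by apply: continuous_subspaceT.
have w2N : {within [set: 'rV[R]_j.+1], continuous (fun x => 2 * N x)}.
  by apply: withincM wN; exact: withinc_cst.
have crho : continuous rho.
  have : {within [set: 'rV[R]_j.+1], continuous (fun x => 2 / Num.max 1 (2 * N x))}.
    apply: withincM; first exact: withinc_cst.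
    apply: withincV => [x _|]; first by rewrite gt_eqF.
    by apply: withinc_max w2N; exact: withinc_cst.
  move=> /withinT_continuous c x.
  by apply: (@cvgZ _ _ _ (nbhs x)); [exact: c|exact: cvg_id].
have csc : continuous sc.
  apply: withinT_continuous; apply: withinc_max; first exact: withinc_cst.
  by apply: withincB w2N _; exact: withinc_cst.
have cnu x : 0 < N x -> {for x, continuous nu}.
  move=> Nx; apply: (@cvgZ _ _ _ (nbhs x)); last exact: cvg_id.
  by apply: cvgV; [rewrite gt_eqF|exact: cN].
pose D v x := f x v - f' x v.
have cD v : {within unit_sphere R j.+1, continuous (D v)} by exact: withincB.
pose g x v := g' (rho x) v + sc x * D v (nu x).
have near_gt (x : 'rV[R]_j.+1) (c : R) : c < N x -> \forall y \near x, c < N y.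
  by move=> h; exact: (cN x _ (lt_nbhsr h)).
have near_lt (x : 'rV[R]_j.+1) (c : R) : N x < c -> \forall y \near x, N y < c.
  by move=> h; exact: (cN x _ (lt_nbhsl h)).
exists g; split=> [v|x Bx|x Sx].
- apply: continuous_subspaceT; apply: withinT_continuous.
  apply: withincD; apply: continuous_subspaceT => x.
    have nB : \forall y \near x, unit_ball R j.+1 (rho y) by near=> y; exact: rhoB.
    exact: (continuous_comp_within (cg' v) (crho x) (rhoB x) nB).
  case: (ltP (N x) (1/2)) => Nx.
    apply: (near_cst_continuous 0); apply: filterS (near_lt x _ Nx) => y Ny.
    by rewrite /sc max_l ?mul0r //; lra.
  have N0 : 0 < N x by lra.
  apply: (@continuousM R _ sc (D v \o nu)); first exact: csc.
  have nS' : \forall y \near x, unit_sphere R j.+1 (nu y).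
    by apply: filterS (near_gt x 0 N0) => y; exact: nuS.
  exact: (continuous_comp_within (cD v) (cnu _ N0) (nuS _ N0) nS').
- case: (lerP (N x) (1/2)) => Nx.
    have -> : g x = g' (rho x).
      apply/funext => v; rewrite /g /sc max_l ?mul0r ?addr0 //; lra.
    by apply: LinK; exact: Lg'.
  have N0 : 0 < N x by lra.
  have rn : rho x = nu x.
    rewrite /rho /nu max_r; last by lra.
    by rewrite invfM mulrA divff // mul1r.
  have Snu := nuS _ N0.
  have -> : g x = fun v => f' (nu x) v + sc x * (f (nu x) v - f' (nu x) v).
    by apply/funext => v; rewrite /g /D rn eg'.
  have [s [sK fs fs']] := car _ Snu.
  apply: (realization_segment dK (Kf _ Snu) (LinK _ (Lf' _ Snu)) sK fs fs').
  rewrite /sc le_max lexx /= ge_max ler01 /=.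
  by have /unit_ballE : unit_ball R j.+1 x by []; rewrite -/(N x); lra.
have N1 : N x = 1 by apply/unit_sphereE.
have rx : rho x = x by rewrite /rho N1 mulr1 max_r ?divff ?scale1r //; lra.
have nx : nu x = x by rewrite /nu N1 invr1 scale1r.
have sx : sc x = 1 by rewrite /sc N1 max_r; lra.
by apply/funext => v; rewrite /g rx nx sx mul1r eg' // /D; lra.
Unshelve. all: by end_near. Qed.
End fills.

(** * Lipschitz maps on the sphere *)

(** Compactness is used in its near-covering form, with the radius tending to 0 from the right as
    parameter. *)
Lemma compact_uniform_continuity (R : realType) (d : nat) (S : set 'rV[R]_d)
    (f : 'rV[R]_d -> R) (e : R) :
  compact S -> {within S, continuous f} -> 0 < e ->
  exists2 r : R, 0 < r & forall x y, S x -> S y -> `|x - y| < r -> `|f x - f y| < e.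
Proof.
move=> cS /subspace_continuousP cf e0.
have /compact_near_coveringP nc := cS.
have := nc R (0^'+)%R (fun r x => forall y, S x -> S y -> `|x - y| < r -> `|f x - f y| < e).
move=> /(_ _)[].
  move=> x Sx; have e20 : 0 < e / 2 by rewrite divr_gt0.
  have /cvgrPdist_lt/(_ _ e20) := cf _ Sx.
  rewrite /within /= => /nbhs_normP[r /= r0 H].
  have r20 : 0 < r / 2 by rewrite divr_gt0.
  exists (ball x (r / 2), [set t : R | t < r / 2]) => /=.
    split; first exact: nbhsx_ballx.
    by near=> t; near: t; exact: nbhs_right_lt.
  move=> [x' t] /= [bx' tr] y Sx' Sy xy.
  rewrite -ball_normE /ball_ /= in bx'.
  have h1 : `|f x - f x'| < e / 2 by apply: H => //=; lra.
  have h2 : `|f x - f y| < e / 2.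
    apply: H => //=; apply: le_lt_trans (ler_distD x' _ _) _; lra.
  by apply: le_lt_trans (ler_distD (f x) _ _) _; rewrite (distrC (f x')); lra.
move=> r /= r0 H; exists (r / 2); first by rewrite divr_gt0.
move=> x y Sx Sy xy; apply: (H (r / 2)) => //=.
  by rewrite sub0r normrN gtr0_norm ?divr_gt0 //; lra.
by rewrite divr_gt0.
Unshelve. all: by end_near. Qed.

(* [w] is the infimal convolution of [f] with a large multiple of the norm. *)
Lemma lipschitz_approx (R : realType) (d : nat) (S : set 'rV[R]_d)
    (f : 'rV[R]_d -> R) (e : R) :
  compact S -> {within S, continuous f} -> (forall x, S x -> 0 <= f x <= 1) ->
  S !=set0 -> 0 < e ->
  exists (w : 'rV[R]_d -> R) (L : R), [/\ 0 <= L,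
    forall x y, `|w x - w y| <= L * `|x - y| & forall x, S x -> `|w x - f x| <= e].
Proof.
move=> cS cf f01 [z Sz] e0.
have [r r0 unif] := compact_uniform_continuity cS cf e0.
pose E x := [set f y + r^-1 * `|x - y| | y in S].
have Elb x : lbound (E x) 0.
  move=> _ [y Sy <-]; apply: addr_ge0; first by case/andP: (f01 _ Sy).
  by rewrite mulr_ge0 // invr_ge0 ltW.
have Ene x : E x !=set0 by exists (f z + r^-1 * `|x - z|), z.
have Ehlb x : has_lbound (E x) by exists 0.
have lip x y : inf (E x) - inf (E y) <= r^-1 * `|x - y|.
  rewrite lerBlDr -lerBlDl; apply: lb_le_inf => // _ [u Su <-].
  rewrite lerBlDl; apply: (@le_trans _ _ (f u + r^-1 * `|x - u|)).
    by apply: ge_inf => //; exists u.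
  have ri : 0 <= r^-1 by rewrite invr_ge0 ltW.
  by have := ler_wpM2l ri (ler_distD y x u); rewrite mulrDr; lra.
exists (fun x => inf (E x)), r^-1; split; first by rewrite invr_ge0 ltW.
  move=> x y; rewrite ler_norml lip andbT lerNl opprB.
  by rewrite distrC; exact: lip.
move=> x Sx; rewrite distrC ger0_norm.
  rewrite lerBlDr -lerBlDl; apply: lb_le_inf => // _ [y Sy <-].
  (* Either [y] is so close that [f y] nearly equals [f x], or the penalty is at least 1, which
     bounds [f x]. *)
  rewrite lerBlDl; case: (ltP `|x - y| r) => xy.
    have := unif _ _ Sx Sy xy; rewrite ltr_norml => /andP[_ h].
    have : 0 <= r^-1 * `|x - y| by rewrite mulr_ge0 // invr_ge0 ltW.
    by lra.
  have h : 1 <= r^-1 * `|x - y| by rewrite mulrC ler_pdivlMr // mul1r.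
  by have /andP[_ fx] := f01 _ Sx; have /andP[fy _] := f01 _ Sy; lra.
rewrite subr_ge0; have : E x (f x) by exists x => //; rewrite subrr normr0 mulr0 addr0.
exact: ge_inf.
Qed.

Lemma unit_sphere_coord (R : realType) (d : nat) (x : 'rV[R]_d) (i : 'I_d) :
  unit_sphere R d x -> `|x ord0 i| <= 1.
Proof.
move=> Sx; have : x ord0 i ^+ 2 <= 1.
  by rewrite -Sx (bigD1 i) //= lerDl; apply: sumr_ge0 => k _; exact: sqr_ge0.
by rewrite -real_normK ?num_real // expr_le1.
Qed.

(* The position of [a] in the subdivision of [-1, 1] into [N] intervals. *)
Definition mesh_index (R : realType) (N : nat) (a : R) : nat :=
  Num.truncn ((a + 1) / 2 * N%:R).

Lemma mesh_index_close (R : realType) (N : nat) (a b : R) : (0 < N)%N ->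
  `|a| <= 1 -> `|b| <= 1 -> mesh_index N a = mesh_index N b -> `|a - b| <= 2 / N%:R.
Proof.
move=> N0; rewrite !ler_norml => /andP[a1 _] /andP[b1 _] e.
have N0' : 0 < N%:R :> R by rewrite ltr0n.
have pos (c : R) : -1 <= c -> 0 <= (c + 1) / 2 * N%:R.
  by move=> c1; rewrite mulr_ge0 // divr_ge0 //; lra.
have E c : (c + 1) / 2 * N%:R = (c * N%:R + N%:R) / 2 :> R by rewrite mulrAC mulrDl mul1r.
have := truncn_itv (pos _ a1); have := truncn_itv (pos _ b1).
rewrite -!/(mesh_index N _) e -(natr1 (mesh_index N b)); move: ((mesh_index N b)%:R) => k.
rewrite !E => /andP[h1 h2] /andP[h3 h4].
by rewrite -mulNr ler_pdivrMr // ler_pdivlMr // mulrBl; apply/andP; split; lra.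
Qed.

Lemma mesh_index_le (R : realType) (N : nat) (a : R) : `|a| <= 1 ->
  (mesh_index N a < N.+1)%N.
Proof.
rewrite ler_norml ltnS => /andP[a1 a2].
rewrite -[leqRHS](@natrK R N) /mesh_index; apply: le_truncn.
by rewrite -[leRHS]mul1r ler_wpM2r //; lra.
Qed.

(* The sphere, of dimension [j], is cut into about [N ^ j] cells of diameter
   O(1/N): a cell records a coordinate of maximal absolute value, its sign, and
   the mesh positions of the other coordinates. *)
Lemma unit_sphere_cells (R : realType) (j N : nat) : (0 < N)%N ->
  exists cell : 'rV[R]_j.+1 -> 'I_j.+1 * bool * {ffun 'I_j -> 'I_N.+1},
    forall x y, unit_sphere R j.+1 x -> unit_sphere R j.+1 y -> cell x = cell y ->
      `|x - y| <= (4 * j.+1 * j.+1)%N%:R / N%:R.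
Proof.
move=> N0; pose top (x : 'rV[R]_j.+1) : 'I_j.+1 := [arg max_(i > ord0) `|x ord0 i|]%O.
exists (fun x => (top x, 0 <= x ord0 (top x),
  [ffun k => inord (mesh_index N (x ord0 (lift (top x) k)))])).
move=> x y Sx Sy []; move ex: (top x) => i <- sg /ffunP cells.
have N0' : 0 < N%:R :> R by rewrite ltr0n.
have close k : `|x ord0 (lift i k) - y ord0 (lift i k)| <= 2 / N%:R.
  apply: mesh_index_close => //; try exact: unit_sphere_coord.
  have := congr1 val (cells k); rewrite !ffunE /=.
  by rewrite !inordK //; apply: mesh_index_le; exact: unit_sphere_coord.
have xle k : `|x ord0 k| <= `|x ord0 i|.
  by rewrite -ex /top; case: Order.TotalTheory.arg_maxP => // i0 _ /(_ k isT).
set u := x ord0 i in sg xle *; set v := y ord0 i in sg *.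
have ui : 1 <= j.+1%:R * `|u|.
  have u1 : `|u| <= 1 by exact: unit_sphere_coord.
  have : 1 <= j.+1%:R * `|u| ^+ 2.
    rewrite -{1}Sx; apply: (@le_trans _ _ (\sum_(k < j.+1) `|u| ^+ 2)).
      apply: ler_sum => k _; rewrite -real_normK ?num_real //.
      by rewrite ler_sqr ?nnegrE.
    by rewrite sumr_const card_ord mulr_natl.
  move=> /le_trans; apply; rewrite ler_wpM2l ?ler0n // expr2.
  by rewrite -[leRHS]mulr1 ler_wpM2l.
(* Since the squares sum to 1, the omitted coordinate is determined by the others up to its sign,
   which the cell records. As [|u|] is at least [1 / j.+1], a bound on the difference of squares
   gives one on [|u - v|]. *)
have uv2 : `|u ^+ 2 - v ^+ 2| <= (4 * j)%N%:R / N%:R.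
  have -> : u ^+ 2 - v ^+ 2 = \sum_(k < j) (y ord0 (lift i k) ^+ 2 - x ord0 (lift i k) ^+ 2).
    rewrite sumrB; move: Sx Sy; rewrite /unit_sphere /= !(bigD1_ord i) //= -/u -/v.
    by lra.
  apply: le_trans (ler_norm_sum _ _ _) _.
  apply: (@le_trans _ _ (\sum_(k < j) (4 / N%:R))); last first.
    by rewrite sumr_const card_ord natrM -mulrA (mulrC j%:R) mulrA mulr_natr.
  apply: ler_sum => k _; rewrite subr_sqr normrM.
  have -> : 4 / N%:R = (2 / N%:R) * 2 :> R by rewrite mulrAC -natrM.
  apply: ler_pM => //; first by rewrite distrC; exact: close.
  apply: le_trans (ler_normD _ _) _.
  have := unit_sphere_coord (lift i k) Sx; have := unit_sphere_coord (lift i k) Sy.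
  by lra.
have uv : `|u - v| <= (4 * j.+1 * j.+1)%N%:R / N%:R.
  have sum_ge : `|u| <= `|u + v|.
    move: sg; case: (lerP 0 u) => u0; case: (lerP 0 v) => v0 // _.
      by rewrite !ger0_norm ?addr_ge0 // lerDl.
    by rewrite !ltr0_norm ?ltrNDl //; lra.
  have h : `|u - v| * `|u| <= (4 * j)%N%:R / N%:R.
    by apply: le_trans uv2; rewrite subr_sqr normrM ler_wpM2l.
  apply: (@le_trans _ _ (j.+1%:R * ((4 * j)%N%:R / N%:R))).
    apply: (@le_trans _ _ (j.+1%:R * `|u| * `|u - v|)); first by rewrite ler_peMl.
    by rewrite -mulrA ler_wpM2l ?ler0n // mulrC.
  rewrite mulrA ler_wpM2r ?invr_ge0 ?(ltW N0') // -natrM ler_nat.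
  by rewrite mulnC leq_mul2r leq_mul2l leqnSn orbT.
rewrite [leLHS]/Num.norm /= mx_normrE; apply/bigmax_leP; split.
  by rewrite divr_ge0 ?ler0n.
move=> [a k] _ /=; rewrite !mxE (ord1 a).
case: (unliftP i k) => [k' ->|->]; last exact: uv.
apply: le_trans (close k') _; rewrite ler_wpM2r ?invr_ge0 ?(ltW N0') // ler_nat.
by rewrite -mulnA (@leq_mul 2 1).
Qed.

(** Pigeonhole: if the whole cube of side [2 * h] were hit, preimages of the [m ^ j.+1] points of a
    grid would lie in different cells, but there are only [2 * j.+1 * (m * c).+1 ^ j] cells. *)
Lemma lipschitz_missing_point (R : realType) (j : nat)
    (W : 'I_j.+1 -> 'rV[R]_j.+1 -> R) (L b h : R) :
  0 <= L -> (forall i x y, `|W i x - W i y| <= L * `|x - y|) -> 0 < h ->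
  exists p : 'I_j.+1 -> R, (forall i, `|p i - b| <= h) /\
    forall x, unit_sphere R j.+1 x -> exists i, W i x <> p i.
Proof.
move=> L0 lip h0; apply: contrapT => none.
have hit (p : 'I_j.+1 -> R) : (forall i, `|p i - b| <= h) ->
    exists x, unit_sphere R j.+1 x /\ forall i, W i x = p i.
  move=> pb; apply: contrapT => nx; apply: none; exists p; split=> // x Sx.
  apply: contrapT => nW; apply: nx; exists x; split=> // i.
  by apply: contrapT => ne; apply: nW; exists i.
set C := (4 * j.+1 * j.+1)%N.
(* With [m * c] mesh intervals the image of a cell has diameter below [h / m], less than the grid
   step [2 * h / m]. *)
pose c := (Num.truncn (L * C%:R / h)).+1.
have cP : L * C%:R < h * c%:R.
  by rewrite [ltRHS]mulrC -ltr_pdivrMr // /c real_truncnS_gt // num_real.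
(* This [m] makes the grid outnumber the cells, as [(m * c).+1 <= m * c.+1]. *)
pose m := (2 * j.+1 * (c.+1) ^ j).+1.
have m0 : 0 < m%:R :> R by rewrite ltr0n.
have c0 : 0 < c%:R :> R by rewrite ltr0n.
have N0 : (0 < m * c)%N by [].
have [cell cellP] := @unit_sphere_cells R j (m * c) N0.
pose grid (s : {ffun 'I_j.+1 -> 'I_m}) (i : 'I_j.+1) : R := b - h + 2 * h * (s i)%:R / m%:R.
have gridb s i : `|grid s i - b| <= h.
  have s0 : 0 <= (s i)%:R :> R by rewrite ler0n.
  have sm : (s i)%:R <= m%:R :> R by rewrite ler_nat ltnW.
  have q0 : 0 <= (s i)%:R / m%:R :> R by rewrite divr_ge0 // ltW.
  have q1 : (s i)%:R / m%:R <= 1 :> R by rewrite ler_pdivrMr // mul1r.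
  rewrite /grid -mulrA; move: q0 q1; move: (_ / _) => q q0 q1.
  by rewrite ler_norml; apply/andP; split; nra.
have [X XP] := choice (fun s => hit (grid s) (gridb s)).
have inj : injective (cell \o X).
  move=> s s' /= e; apply/ffunP => i; apply/val_inj.
  have [[Xs Ws] [Xs' Ws']] := (XP s, XP s').
  have := le_trans (lip i (X s) (X s')) (ler_wpM2l L0 (cellP _ _ Xs Xs' e)).
  rewrite Ws Ws' /grid.
  have -> : b - h + 2 * h * (s i)%:R / m%:R - (b - h + 2 * h * (s' i)%:R / m%:R) =
      2 * h / m%:R * ((s i)%:R - (s' i)%:R) by field; rewrite gt_eqF.
  rewrite normrM gtr0_norm ?divr_gt0 ?mulr_gt0 // => H.
  have lt1 : `|(s i)%:R - (s' i)%:R| < 1 :> R.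
    rewrite -(@ltr_pM2l _ (2 * h / m%:R)) ?divr_gt0 ?mulr_gt0 // mulr1.
    apply: le_lt_trans H _; rewrite [(m * c)%:R]natrM invfM !mulrA ltr_pdivrMr //.
    rewrite ltr_pdivrMr // mulrAC divfK ?gt_eqF //.
    by apply: lt_trans cP _; rewrite ltr_pM2r //; lra.
  apply/eqP; move: lt1; case: (ltngtP (s i) (s' i)) => // lt.
    rewrite distrC -natrB ?(ltnW lt) // normr_nat -[1]/(1%:R) ltr_nat.
    by rewrite ltnS leqn0 subn_eq0 leqNgt lt.
  by rewrite -natrB ?(ltnW lt) // normr_nat -[1]/(1%:R) ltr_nat ltnS leqn0 subn_eq0 leqNgt lt.
have := leq_card _ inj.
rewrite !card_prod !card_ffun !card_ord card_bool expnS => le.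
have : (m * m ^ j <= 2 * j.+1 * c.+1 ^ j * m ^ j)%N.
  apply: leq_trans le _; rewrite (mulnC j.+1) -!mulnA !leq_mul2l /= -expnMn.
  case: (j) => [|j']; first by rewrite !expn0.
  by rewrite leq_exp2r // mulSn mulnC -addn1 addnC leq_add2r.
by rewrite leq_pmul2r ?expn_gt0 // ltnn.
Qed.

(** * Collapses and critical cells *)

Section pushes.
Variables (R : realType) (V : finType).
Implicit Types (K L : {set {set V}}) (y : V -> R) (s t : {set V}).

Lemma suppP y s : reflect (forall v, v \notin s -> y v = 0) (supp y \subset s).
Proof.
apply: (iffP fintype.subsetP) => [ys v vs|H v].
  by apply/eqP; apply: contraNT vs => nz; apply: ys; rewrite inE.
by rewrite inE => nz; apply: contraNT nz => /H ->.
Qed.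

Lemma realization_le1 K y v : geometric_realization R K y -> y v <= 1.
Proof.
by case=> y0 <- _; rewrite (bigD1 v) //= lerDl sumr_ge0.
Qed.

Definition min_on s y : R := \big[Num.min/1]_(u in s) y u.

Lemma min_on_le s y u : u \in s -> min_on s y <= y u.
Proof. exact: bigmin_le_cond. Qed.

Lemma min_on_attained K s y : geometric_realization R K y -> s != finset.set0 ->
  exists2 u, u \in s & min_on s y = y u.
Proof.
move=> Ky /finset.set0Pn[u us].
have [i _|i si e] := @eq_bigmin _ R _ 1 u (mem s) y us; first exact: realization_le1 Ky.
by exists i.
Qed.

Lemma min_on_ge0 K s y : geometric_realization R K y -> 0 <= min_on s y.
Proof. by case=> y0 _ _; apply/bigmin_geP; split. Qed.

Lemma min_on_gt0 s y : 0 < min_on s y -> s \subset supp y.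
Proof.
move=> m0; apply/fintype.subsetP => u us; rewrite inE gt_eqF //.
exact: lt_le_trans m0 (min_on_le y us).
Qed.

Definition vertex_complex (v : V) : {set {set V}} :=
  [set finset.set0; [set v]%SET]%SET.

(** The realization is the single point [c], so [f] is already constant on the sphere. *)
Lemma fills_vertex j v : fills R j (vertex_complex v).
Proof.
move=> f cf Kf; pose c (w : V) : R := (w == v)%:R.
have cE y : geometric_realization R (vertex_complex v) y -> y = c.
  case=> y0 y1 ys; have yv : supp y \subset [set v]%SET.
    by move: ys; rewrite !inE => /orP[]/eqP; rewrite /supp => ->; rewrite ?finset.sub0set.
  have yz w : w != v -> y w = 0 by move=> wv; apply: (suppP _ _ yv); rewrite inE.
  apply/funext => w; rewrite /c; case: eqVneq => [->|/yz//].
  by rewrite -y1 (bigD1 v) //= big1 ?addr0 // => u /yz.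
have cK : geometric_realization R (vertex_complex v) c.
  split=> [w||]; first by rewrite ler0n.
    by rewrite (bigD1 v) //= big1 ?addr0 /c ?eqxx // => u /negbTE ->.
  rewrite !inE; apply/orP; right; apply/eqP/setP => w; rewrite !inE /c.
  by rewrite pnatr_eq0 eqb0 negbK.
exists (fun=> c); split=> // [w|x Sx]; first exact: withinc_cst.
by rewrite (cE _ (Kf _ Sx)).
Qed.

(* Elementary collapse: the mass common to the vertices of the free face [s] is
   moved to the remaining vertex [v]. *)
Lemma fills_collapse j K s v : down_closed K -> v |: s \in K -> v \notin s ->
  s != finset.set0 -> (forall r : {set V}, r \in K -> s \subset r -> r = s \/ r = v |: s) ->
  fills R j (K :\: [set s; v |: s]%SET) -> fills R j K.
Proof.
move=> dK tK vs s0 free fL f cf Kf.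
pose m x := min_on s (f x).
pose f' x u := f x u - m x * (u \in s)%:R + m x * #|s|%:R * (u == v)%:R.
have cm : {within unit_sphere R j.+1, continuous m} by exact: withinc_bigmin.
have cf' u : {within unit_sphere R j.+1, continuous (fun x => f' x u)}.
  apply: withincD; first by apply: withincB (cf u) _; apply: withincM cm _; exact: withinc_cst.
  by apply: withincM; [apply: withincM cm _|]; exact: withinc_cst.
have f'0 x : m x = 0 -> f' x = f x.
  by move=> m0; apply/funext => u; rewrite /f' m0 !mul0r subr0 addr0.
have sub_t x : unit_sphere R j.+1 x -> 0 < m x -> supp (f x) \subset v |: s.
  move=> /Kf[_ _ sK] /min_on_gt0 /(free _ sK)[]; rewrite -/(supp (f x)) => -> //.
  exact: finset.subsetUr.
have sub_t' x : unit_sphere R j.+1 x -> 0 < m x -> supp (f' x) \subset v |: s.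
  move=> Sx mx; apply/suppP => u; rewrite !inE negb_or => /andP[uv us].
  rewrite /f' (negbTE uv) (negbTE us) !mulr0 subr0 addr0.
  by apply: (suppP _ _ (sub_t x Sx mx)); rewrite !inE negb_or uv.
have carrier x : unit_sphere R j.+1 x -> exists r : {set V},
    [/\ r \in K, supp (f x) \subset r & supp (f' x) \subset r].
  move=> Sx; have := min_on_ge0 s (Kf _ Sx); rewrite -/(m x) le_eqVlt => /orP[/eqP m0|m0].
    by have [_ _ sK] := Kf _ Sx; exists (supp (f x)); rewrite f'0.
  by exists (v |: s); rewrite sub_t ?sub_t'.
apply: (fills_carried dK _ fL cf cf' Kf _ carrier) => [|x Sx]; first exact: finset.subsetDl.
have [f0 f1 _] := Kf _ Sx; have m0 := min_on_ge0 s (Kf _ Sx); rewrite -/(m x) in m0.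
(* The vertex [u] attaining the minimum leaves the support, which therefore is neither [s] nor
   [v |: s]. *)
have [u us mu] := min_on_attained (Kf _ Sx) s0; rewrite -/(m x) in mu.
have uv : u != v by apply: contraNneq vs => <-.
have f'u : f' x u = 0 by rewrite /f' us (negbTE uv) mulr1 mulr0 addr0 mu subrr.
have us' : u \notin supp (f' x) by rewrite inE negbK f'u.
split=> [w||].
- apply: addr_ge0; last by rewrite !mulr_ge0 ?ler0n.
  case: (boolP (w \in s)) => ws; last by rewrite mulr0 subr0.
  by rewrite mulr1 subr_ge0; exact: min_on_le.
- rewrite big_split /= sumrB f1 -!mulr_sumr.
  have -> : \sum_w (w \in s)%:R = #|s|%:R :> R.
    by rewrite -sum1_card natr_sum [RHS]big_mkcond; apply: eq_bigr => w _; case: (w \in s).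
  have -> : \sum_w (w == v)%:R = 1 :> R.
    by rewrite (bigD1 v) //= eqxx big1 ?addr0 // => w /negbTE ->.
  by rewrite mulr1 subrK.
rewrite -/(supp (f' x)) !inE negb_or; apply/andP; split.
  apply/andP; split; apply: contraNneq us' => ->; first by [].
  by rewrite !inE us orbT.
have [r [rK _ /(dK _ _ rK)]] := carrier _ Sx; exact.
Qed.

End pushes.

(** * Compactness of the sphere, affine coordinates and radial projection *)

Lemma unit_sphere_nonempty (R : realType) (j : nat) : unit_sphere R j.+1 !=set0.
Proof.
exists (\row_k (k == ord0)%:R); rewrite /unit_sphere /= (bigD1 ord0) //= mxE eqxx expr1n.
by rewrite big1 ?addr0 // => k /negbTE k0; rewrite mxE k0 expr0n.
Qed.

Lemma unit_sphere_compact (R : realType) (d : nat) : compact (unit_sphere R d).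
Proof.
apply: bounded_closed_compact.
  exists 1; split; first exact: num_real.
  move=> M M1 x Sx /=; rewrite [leLHS]/Num.norm /= mx_normrE; apply/bigmax_leP; split; first lra.
  by move=> [a k] _ /=; rewrite (ord1 a); have := unit_sphere_coord k Sx; lra.
have -> : unit_sphere R d = @enorm R d @^-1` [set 1].
  by apply/seteqP; split=> x /unit_sphereE.
apply: closed_comp; first by move=> x _; exact: enorm_continuous.
exact: closed_eq.
Qed.

Section barycentric.
Variables (R : realType) (V : finType).
Implicit Types (y a c : V -> R) (s : {set V}).

(* The point of the affine span of [s] with coordinates [a] off [u0]. *)
Definition affine_point s (u0 : V) a (u : V) : R :=
  if u \in s then (if u == u0 then 1 - \sum_(w in s | w != u0) a w else a u) else 0.

Lemma sum_affine_point s u0 a : u0 \in s -> \sum_u affine_point s u0 a u = 1.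
Proof.
move=> us; rewrite (bigID (mem s)) /= [X in _ + X]big1 ?addr0; last first.
  by move=> u /negbTE us'; rewrite /affine_point us'.
rewrite (bigD1 u0) //= {1}/affine_point us eqxx.
under [X in _ + X]eq_bigr => u /andP[us' /negbTE un] do rewrite /affine_point us' un.
by rewrite subrK.
Qed.

Lemma affine_point_id s u0 c : u0 \in s -> supp c \subset s -> \sum_u c u = 1 ->
  affine_point s u0 c = c.
Proof.
move=> us /suppP cs c1; apply/funext => u; rewrite /affine_point.
case: (boolP (u \in s)) => [us'|/cs->//]; case: eqVneq => // ->.
rewrite -c1 (bigID (mem s)) /= [X in _ + X - _]big1 ?addr0 //.
by rewrite (bigD1 u0) //= addrK.
Qed.

(** The coordinate at [u0] collects the errors of the others, whence the factor [#|s|]. *)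
Lemma affine_point_close s u0 a c (e : R) : 0 <= e ->
  (forall w, w \in s -> `|a w - c w| <= e) ->
  forall u, `|affine_point s u0 a u - affine_point s u0 c u| <= #|s|%:R * e.
Proof.
move=> e0 ac u; have se : 0 <= #|s|%:R * e by rewrite mulr_ge0.
rewrite /affine_point; case: (boolP (u \in s)) => us; last by rewrite subrr normr0.
case: eqVneq => un.
  rewrite opprB addrC addrA subrK -sumrB.
  apply: le_trans (ler_norm_sum _ _ _) _.
  apply: (@le_trans _ _ (\sum_(w in s) e)).
    rewrite [leLHS]big_mkcondr; apply: ler_sum => w ws.
    by case: ifP => // _; rewrite distrC; exact: ac.
  by rewrite sumr_const mulr_natl.
apply: le_trans (ac _ us) _; rewrite ler_peMl // ler1n card_gt0.
by apply/finset.set0Pn; exists u.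
Qed.

End barycentric.

Section push.
Variables (R : realType) (V : finType).
Implicit Types (K L : {set {set V}}) (y : V -> R) (s t : {set V}).

(* Radial projection of a simplex, punctured at the interior point [p], onto its
   boundary; it is the identity on the rest of the complex. *)
Definition radial s (p y : V -> R) (u : V) : R :=
  p u + (y u - p u) / \big[Num.max/0]_(w in s) (1 - y w / p w).

(** A coordinate of [y] vanishing on [s] makes the denominator equal to 1. *)
Lemma radial_fix K s p y : geometric_realization R K y ->
  (forall u, u \in s -> 0 < p u) -> (exists2 u, u \in s & y u = 0) -> radial s p y = y.
Proof.
move=> [y0 _ _] p0 [u us yu].
suff q1 : \big[Num.max/0]_(w in s) (1 - y w / p w) = 1.
  by apply/funext => v; rewrite /radial q1 divr1; lra.
apply/eqP; rewrite eq_le; apply/andP; split.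
  apply/bigmax_leP; split=> // w ws; rewrite gerBl divr_ge0 //; exact/ltW/p0.
by apply: (bigmax_sup u) => //; rewrite yu mul0r subr0.
Qed.

(** Otherwise [y] is at least [p] in every coordinate, and equal sums force [y = p]. *)
Lemma radial_gt0 s p y : supp y \subset s -> supp p \subset s ->
  (forall u, u \in s -> 0 < p u) -> \sum_u y u = \sum_u p u -> y <> p ->
  0 < \big[Num.max/0]_(w in s) (1 - y w / p w).
Proof.
move=> /suppP ys /suppP ps p0 e ne; rewrite ltNge; apply/negP => /bigmax_leP[_ le].
have ge u : 0 <= y u - p u.
  case: (boolP (u \in s)) => us; last by rewrite ys // ps // subrr.
  by have := le _ us; rewrite subr_le0 ler_pdivlMr ?p0 // mul1r subr_ge0.
apply: ne; apply/funext => u; apply/eqP; rewrite -subr_eq0.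
have : \sum_u (y u - p u) = 0 by rewrite sumrB e subrr.
by move/(psumr_eq0P (fun v _ => ge v)) => ->.
Qed.

(** The denominator is the largest relative deficit of [y] against [p]. Dividing by it brings the
    coordinate with this deficit exactly to 0 and leaves the others nonnegative. *)
Lemma radial_boundary s p y : supp y \subset s -> supp p \subset s ->
  (forall u, 0 <= y u) -> (forall u, u \in s -> 0 < p u) ->
  \sum_u y u = 1 -> \sum_u p u = 1 ->
  0 < \big[Num.max/0]_(w in s) (1 - y w / p w) ->
  [/\ forall u, 0 <= radial s p y u, \sum_u radial s p y u = 1,
      supp (radial s p y) \subset s & exists2 u, u \in s & radial s p y u = 0].
Proof.
move=> /suppP ys /suppP ps y0 p0 y1 p1; rewrite /radial.
set q := \big[_/_]_(_ in _) _ => q0.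
have off u : u \notin s -> p u + (y u - p u) / q = 0.
  by move=> us; rewrite ys // ps // subrr mul0r addr0.
split.
- move=> u; case: (boolP (u \in s)) => us; last by rewrite off.
  have : 1 - y u / p u <= q by exact: le_bigmax_cond.
  rewrite lerBlDr -lerBlDl ler_pdivlMr ?p0 // => h.
  have -> : p u + (y u - p u) / q = (y u - (1 - q) * p u) / q by field; rewrite gt_eqF.
  by rewrite divr_ge0 ?(ltW q0) // subr_ge0.
- by rewrite big_split /= -mulr_suml sumrB y1 p1 subrr mul0r addr0.
- by apply/suppP.
apply: contrapT => nex; suff : q < q by rewrite ltxx.
apply/bigmax_ltP; split=> // u us; rewrite ltNge; apply/negP => h; apply: nex.
have e : 1 - y u / p u = q by apply/eqP; rewrite eq_le h andbT; exact: le_bigmax_cond.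
exists u => //; have pu := p0 _ us.
have qn : q != 0 by rewrite gt_eqF.
have -> : y u = p u * (1 - q) by rewrite -e opprB addrC subrK mulrC divfK // gt_eqF.
by field.
Qed.
End push.

Lemma lipschitz_within (R : realType) (d : nat) (A : set 'rV[R]_d) (w : 'rV[R]_d -> R) (L : R) :
  (forall x y, `|w x - w y| <= L * `|x - y|) -> {within A, continuous w}.
Proof.
move=> lip; apply: continuous_subspaceT => x N /nbhs_ballP[e /= e0 eN].
pose M := `|L| + 1; have M0 : 0 < M by rewrite ltr_wpDl.
apply/nbhs_ballP; exists (e / M) => /=; first by rewrite divr_gt0.
move=> y; rewrite -ball_normE /ball_ /= => xy; apply: eN; rewrite -ball_normE /ball_ /=.
apply: le_lt_trans (lip x y) _; apply: (@le_lt_trans _ _ (M * `|x - y|)).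
  by rewrite ler_wpM2r // (le_trans (ler_norm L)) // lerDl.
by rewrite mulrC -ltr_pdivlMr.
Qed.

Lemma withinc_affine_point (R : realType) (V : finType) (T : topologicalType)
    (A : set T) (s : {set V}) (u0 u : V) (a : T -> V -> R) :
  (forall v, {within A, continuous (fun x => a x v)}) ->
  {within A, continuous (fun x => affine_point s u0 (a x) u)}.
Proof.
move=> ca; rewrite /affine_point; case: (u \in s); last exact: withinc_cst.
case: (u == u0) => //; apply: withincB; first exact: withinc_cst.
exact: withinc_sum.
Qed.

(* [f] is perturbed where it enters the open cell [s] to miss an interior point
   [p] of [s], and then pushed off [s] by the projection from [p]. *)
Lemma fills_push (R : realType) (V : finType) (j : nat) (K : {set {set V}}) (s : {set V}) :
  down_closed K -> s \in K -> (forall r : {set V}, r \in K -> s \subset r -> r = s) ->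
  (j.+2 <= #|s|)%N -> fills R j (K :\ s)%SET -> fills R j K.
Proof.
move=> dK sK smax js fL f cf Kf.
have [u1 u1s] : exists u, u \in s by apply/card_gt0P; exact: leq_trans js.
have s0 : s != finset.set0 by apply/finset.set0Pn; exists u1.
pose D : R := #|s|%:R.
have D0 : 0 < D by rewrite ltr0n card_gt0.
(* [b] is the coordinate of the barycenter. An error [ep] in each coordinate becomes at most [de] in
   the affine point, and [p] will be at least [2 * de] on [s]. *)
pose b := D^-1; have b0 : 0 < b by rewrite invr_gt0.
pose de := b / 4; have de0 : 0 < de by rewrite divr_gt0.
pose ep := de / D; have ep0 : 0 < ep by rewrite divr_gt0.
(* The map will miss [p] in the [j.+1] coordinates [U i]; a further vertex [us] keeps the sum equal
   to 1. This is where [j.+2 <= #|s|] enters. *)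
pose U (i : 'I_j.+1) := nth u1 (enum s) i.
pose us := nth u1 (enum s) j.+1.
have szs : size (enum s) = #|s| by rewrite cardE.
have uS i : (i < j.+2)%N -> nth u1 (enum s) i \in s.
  by move=> ij; rewrite -mem_enum mem_nth // szs (leq_trans ij).
have Us i : U i \in s by apply: uS; exact: ltn_trans (ltn_ord i) _.
have uss : us \in s by exact: uS.
have Ueq i k : (i < j.+2)%N -> (k < j.+2)%N ->
    (nth u1 (enum s) i == nth u1 (enum s) k) = (i == k).
  by move=> ij kj; rewrite nth_uniq ?enum_uniq ?szs ?(leq_trans ij) ?(leq_trans kj).
have Uinj : injective U.
  by move=> i k /eqP; rewrite Ueq ?(ltn_trans (ltn_ord _)) // => /eqP/val_inj.
have Uus i : U i != us by rewrite Ueq ?(ltn_trans (ltn_ord _)) // ltn_eqF.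
have approx v : exists wv : 'rV[R]_j.+1 -> R, exists L : R, [/\ 0 <= L,
    forall x y, `|wv x - wv y| <= L * `|x - y|
    & forall x, unit_sphere R j.+1 x -> `|wv x - f x v| <= ep].
  apply: lipschitz_approx => //; first exact: unit_sphere_compact.
    by move=> x Sx; have [f0 _ _] := Kf _ Sx; rewrite f0 (realization_le1 v (Kf _ Sx)).
  exact: unit_sphere_nonempty.
have [w wP] := choice approx.
have {wP} [L LP] := choice wP.
have L0 : 0 <= \sum_v L v by apply: sumr_ge0 => v _; have [] := LP v.
have wlip v x y : `|w v x - w v y| <= (\sum_v L v) * `|x - y|.
  have [_ h _] := LP v; apply: le_trans (h x y) _; rewrite ler_wpM2r //.
  by rewrite (bigD1 v) //= lerDl sumr_ge0 // => u _; have [] := LP u.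
have wclose v x : unit_sphere R j.+1 x -> `|w v x - f x v| <= ep by have [_ _] := LP v; exact.
have cw v : {within unit_sphere R j.+1, continuous (w v)}.
  exact: lipschitz_within (wlip v).
(* The factor [#|s|] from [affine_point_close] turns this radius into [b / 2]. *)
have [|pc [pcb miss]] := lipschitz_missing_point b L0 (fun i => wlip (U i)) (_ : 0 < b / (2 * D)).
  by rewrite divr_gt0 ?mulr_gt0.
pose p0 v := if [pick i | U i == v] is Some i then pc i else b.
have p0U i : p0 (U i) = pc i.
  by rewrite /p0; case: pickP => [k /eqP/Uinj->//|/(_ i)]; rewrite eqxx.
have p0b v : `|p0 v - b| <= b / (2 * D).
  rewrite /p0; case: pickP => [k _|_]; first exact: pcb.
  by rewrite subrr normr0 divr_ge0 ?mulr_ge0 // ltW.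
pose p := affine_point s us p0.
pose bs v : R := if v \in s then b else 0.
have bs1 : \sum_v bs v = 1.
  by rewrite -big_mkcond sumr_const -[b *+ _]mulr_natl divff // gt_eqF.
have bss : supp bs \subset s by apply/suppP => v /negbTE vs; rewrite /bs vs.
have pb v : v \in s -> `|p v - b| <= b / 2.
  move=> vs; have := @affine_point_close R V s us p0 bs _ _ _ v.
  have bv : bs v = b by rewrite /bs vs.
  rewrite (affine_point_id uss bss bs1) bv => h.
  apply: le_trans (h (b / (2 * D)) _ _) _; first by rewrite divr_ge0 ?mulr_ge0 // ltW.
    by move=> u us'; rewrite /bs us'.
  by rewrite -/D le_eqVlt; apply/orP; left; apply/eqP; field; rewrite gt_eqF.
have p1 : \sum_v p v = 1 by exact: sum_affine_point.
have ps : supp p \subset s by apply/suppP => v /negbTE vs; rewrite /p /affine_point vs.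
have pge v : v \in s -> 2 * de <= p v.
  by move=> /pb; rewrite ler_norml /de => /andP[]; lra.
have pgt v : v \in s -> 0 < p v by move=> /pge; lra.
pose m x := min_on s (f x).
pose W x := affine_point s us (fun v => w v x).
(* The cutoff is 0 off the open cell and 1 where all coordinates on [s] are at least [de]. Since
   [phi x * de <= m x], the perturbed coordinates stay nonnegative. *)
pose phi x : R := Num.min 1 (m x / de).
pose f1 x v := f x v + phi x * (W x v - f x v).
pose f2 x := radial s p (f1 x).
have sub_s x : unit_sphere R j.+1 x -> 0 < m x -> supp (f x) \subset s.
  by move=> Sx m0; have [_ _ fK] := Kf _ Sx; have -> : supp (f x) = s := smax _ fK (min_on_gt0 m0).
have Wclose x v : unit_sphere R j.+1 x -> 0 < m x -> `|W x v - f x v| <= de.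
  move=> Sx m0; have [_ fx1 _] := Kf _ Sx.
  have := @affine_point_close R V s us (fun v => w v x) (f x) ep (ltW ep0) _ v.
  rewrite (affine_point_id uss (sub_s _ Sx m0) fx1) -/D -/(W x) => h.
  apply: le_trans (h _) _; first by move=> u _; exact: wclose.
  by rewrite /ep mulrC divfK // gt_eqF.
have m_ge0 x : unit_sphere R j.+1 x -> 0 <= m x by move=> Sx; exact: min_on_ge0 (Kf _ Sx).
have phi01 x : unit_sphere R j.+1 x -> 0 <= phi x <= 1.
  by move=> Sx; rewrite /phi le_min ler01 divr_ge0 ?m_ge0 ?(ltW de0) //= ge_min lexx.
have f1_0 x : m x = 0 -> f1 x = f x.
  by move=> m0; apply/funext => v; rewrite /f1 /phi m0 mul0r min_r // mul0r addr0.
have f1_s x : unit_sphere R j.+1 x -> 0 < m x ->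
    [/\ forall v, 0 <= f1 x v, \sum_v f1 x v = 1 & supp (f1 x) \subset s].
  move=> Sx m0; have [fx0 fx1 _] := Kf _ Sx; have /suppP fs := sub_s _ Sx m0.
  have f1s v : v \notin s -> f1 x v = 0.
    by move=> vs; rewrite /f1 /W /affine_point (negbTE vs) fs // subrr mulr0 addr0.
  have /andP[ph0 ph1] := phi01 _ Sx.
  split; last by apply/suppP.
    move=> v; case: (boolP (v \in s)) => vs; last by rewrite f1s.
    have := Wclose _ v Sx m0; rewrite ler_norml => /andP[h _].
    have mf : m x <= f x v by exact: min_on_le.
    have pm : phi x * de <= m x by rewrite -ler_pdivlMr // /phi ge_min lexx orbT.
    have := ler_wpM2l ph0 h; rewrite mulrN /f1; lra.
  by rewrite /f1 big_split /= -mulr_sumr sumrB sum_affine_point // fx1 subrr mulr0 addr0.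
have f1_p x : unit_sphere R j.+1 x -> f1 x <> p.
  move=> Sx e; have := m_ge0 _ Sx; rewrite le_eqVlt => /orP[/eqP m0|m0].
    have [u us' mu] := min_on_attained (Kf _ Sx) s0; have := pgt _ us'.
    by rewrite -e f1_0 // -mu -/(m x) -m0 ltxx.
  have /andP[ph0 ph1] := phi01 _ Sx.
  (* [p] is at least [2 * de] on [s] and the perturbation at most [de]. Hence [phi x = 1], and
     [f1 x] is the Lipschitz approximation, which misses [p]. *)
  have mde : de <= m x.
    have [u us' mu] := min_on_attained (Kf _ Sx) s0; rewrite -/(m x) in mu.
    have := pge _ us'; rewrite -e /f1 -mu => h.
    have := Wclose _ u Sx m0; rewrite -mu ler_norml => /andP[_ h'].
    have := ler_wpM2l ph0 h'; have : phi x * de <= de by rewrite ler_piMl // ltW.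
    lra.
  have ph : phi x = 1 by rewrite /phi min_l // ler_pdivlMr // mul1r.
  have [i] := miss _ Sx; apply.
  have := congr1 (fun y : V -> R => y (U i)) e.
  rewrite /f1 ph mul1r addrC subrK /W /p /affine_point Us (negbTE (Uus i)) p0U; exact.
have zero x : unit_sphere R j.+1 x -> m x = 0 -> exists2 u, u \in s & f x u = 0.
  by move=> Sx m0; have [u us' mu] := min_on_attained (Kf _ Sx) s0; exists u; rewrite // -mu.
have f2_0 x : unit_sphere R j.+1 x -> m x = 0 -> f2 x = f x.
  move=> Sx m0; rewrite /f2 f1_0 //; apply: (radial_fix (Kf _ Sx) pgt); exact: zero.
have q_gt0 x : unit_sphere R j.+1 x -> 0 < \big[Num.max/0]_(u in s) (1 - f1 x u / p u).
  move=> Sx; have := m_ge0 _ Sx; rewrite le_eqVlt => /orP[/eqP m0|m0].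
    have [u us' fu] := zero _ Sx (esym m0).
    rewrite (lt_le_trans ltr01) //; apply: (bigmax_sup u) => //.
    by rewrite f1_0 // fu mul0r subr0.
  have [_ f11 f1ss] := f1_s _ Sx m0.
  by apply: radial_gt0 => //; [rewrite f11 p1|exact: f1_p].
have f2_s x : unit_sphere R j.+1 x -> 0 < m x ->
    [/\ forall u, 0 <= f2 x u, \sum_u f2 x u = 1,
      supp (f2 x) \subset s & exists2 u, u \in s & f2 x u = 0].
  by move=> Sx m0; have [? ? ?] := f1_s _ Sx m0; apply: radial_boundary => //; exact: q_gt0.
have cm : {within unit_sphere R j.+1, continuous m} by exact: withinc_bigmin.
have cphi : {within unit_sphere R j.+1, continuous phi}.
  apply: withinc_min; first exact: withinc_cst.
  by apply: withincM cm _; exact: withinc_cst.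
have cf1 v : {within unit_sphere R j.+1, continuous (fun x => f1 x v)}.
  apply: withincD => //; apply: withincM => //; apply: withincB => //.
  exact: withinc_affine_point.
have cf2 v : {within unit_sphere R j.+1, continuous (fun x => f2 x v)}.
  apply: withincD; first exact: withinc_cst.
  apply: withincM; first by apply: withincB => //; exact: withinc_cst.
  apply: withincV; first by move=> x Sx; rewrite gt_eqF ?q_gt0.
  apply: withinc_bigmax => u; apply: withincB; first exact: withinc_cst.
  by apply: withincM => //; exact: withinc_cst.
apply: (fills_carried dK _ fL cf cf2 Kf).
- exact: finset.subD1set.
- move=> x Sx; have := m_ge0 _ Sx; rewrite le_eqVlt => /orP[/eqP m0|m0].
    have [h1 h2 h3] := Kf _ Sx; rewrite f2_0 //; split=> //.
    rewrite -/(supp _) in h3 *; rewrite !inE h3 andbT.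
    have [u us' fu] := zero _ Sx (esym m0).
    by apply: contraTneq us' => <-; rewrite inE negbK fu.
  have [h1 h2 h3 [u us' fu]] := f2_s _ Sx m0; split=> //.
  rewrite -/(supp _) !inE (dK _ _ sK h3) andbT.
  by apply: contraTneq us' => <-; rewrite inE negbK fu.
move=> x Sx; have := m_ge0 _ Sx; rewrite le_eqVlt => /orP[/eqP m0|m0].
  by have [_ _ h] := Kf _ Sx; exists (supp (f x)); rewrite f2_0.
by have [_ _ h _] := f2_s _ Sx m0; exists s; rewrite (sub_s _ Sx m0).
Qed.

(** * Connectivity from an acyclic matching *)

(** Take [x] in [L] from which the most points are reachable: a predecessor in [L] would reach all
    of these and itself, which [x] cannot reach. *)
Lemma acyclic_source (T : finType) (e : rel T) (L : {set T}) :
  (forall c, path.cycle e c -> c = [::]) -> L != finset.set0 ->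
  exists2 x, x \in L & forall y, y \in L -> ~~ e y x.
Proof.
move=> ac /finset.set0Pn[x0 x0L].
case: (@arg_maxnP _ x0 (mem L) (fun x => #|connect e x|)) => // x xL max.
exists x => // y yL; apply/negP => eyx; have le : (#|connect e y| <= #|connect e x|)%N := max y yL.
move: le; rewrite leqNgt => /negP; apply; apply: proper_card; apply/properP; split.
  by apply/fintype.subsetP => z; apply: connect_trans (connect1 eyx).
exists y; first exact: connect0.
apply/negP => /connectP[p pp ey].
by have := ac (x :: p); rewrite /= rcons_path pp -ey eyx => /(_ isT).
Qed.

Section morse.
Variables (V : finType) (K : {set {set V}}) (M : {set {set {set V}}}).
Hypothesis dK : down_closed K.
Hypothesis aM : acyclic_matching K M.

Lemma matching_edge (e : {set {set V}}) : e \in M ->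
  exists s t, covers K s t /\ e = [set s; t]%SET.
Proof.
case: aM => /andP[_ /forall_inP h] _ /h /existsP[s /existsP[t /andP[c /eqP ->]]].
by exists s, t.
Qed.

Lemma matching_unique (e1 e2 : {set {set V}}) (s : {set V}) :
  e1 \in M -> e2 \in M -> s \in e1 -> s \in e2 -> e1 = e2.
Proof.
case: aM => /andP[/finset.trivIsetP tr _] _ h1 h2 s1 s2.
apply: contraTeq s1 => /(tr _ _ h1 h2) /disjointFl -> //.
Qed.

(* Faces are peeled off at a source of the Morse digraph: such a face is either
   critical and maximal, or a free face matched to its only proper coface. *)
Lemma morse_induction (P : {set {set V}} -> Prop) :
  finset.set0 \in K -> finset.set0 \in finset.cover M ->
  (forall v, P (vertex_complex v)) ->
  (forall L s v, down_closed L -> v |: s \in L -> v \notin s -> s != finset.set0 ->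
    (forall r : {set V}, r \in L -> s \subset r -> r = s \/ r = v |: s) ->
    P (L :\: [set s; v |: s]%SET) -> P L) ->
  (forall L s, down_closed L -> s \in L -> s \in K :\: finset.cover M ->
    (forall r : {set V}, r \in L -> s \subset r -> r = s) ->
    P (L :\ s)%SET -> P L) ->
  P K.
Proof.
move=> K0 M0 Pv Pcol Pcrit.
(* The induction runs over subcomplexes that contain the mate of each of their matched faces. *)
suff gen (k : nat) (L : {set {set V}}) : (#|L| < k)%N -> L \subset K -> down_closed L ->
    finset.set0 \in L ->
    (forall e, e \in M -> forall s t, s \in e -> t \in e -> s \in L -> t \in L) -> P L.
  apply: (gen #|K|.+1) => // e eM s t se te _.
  have [s' [t' [/and4P[sK tK _ _] e_]]] := matching_edge eM.
  by move: te; rewrite e_ !inE => /orP[]/eqP->.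
elim: k L => // k IH L lk LK dL L0 closed.
have Ln : L != finset.set0 by apply/finset.set0Pn; exists finset.set0.
have [x xL src] := acyclic_source aM.2 Ln.
have cov (s t : {set V}) : t \in L -> s \subset t -> #|t| = #|s|.+1 -> covers K s t.
  by move=> tL st c; rewrite coversE // (fintype.subsetP LK _ tL) st c eqxx.
(* A coface of [x] in [L] with one more vertex is matched with [x]. *)
have up v : v \notin x -> v |: x \in L -> [set x; v |: x]%SET \in M.
  move=> vx vL; have := src _ vL; rewrite /morse_arc negb_or => /andP[_].
  rewrite cov ?finset.subsetUr ?cardsU1 ?vx //= negbK.
  by rewrite finset.setUC.
have pair_neq v : v \notin x -> x != v |: x.
  by move=> vx; apply: contraNneq vx => ->; rewrite finset.setU11.
(* As [x] is matched only once, a single vertex can be added to it within [L]; by down-closure no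
   further coface exists. *)
have uniq_v v w : v \notin x -> v |: x \in L -> w \notin x -> w |: x \in L -> v = w.
  move=> vx vL wx wL.
  have e : [set x; v |: x]%SET = [set x; w |: x]%SET.
    by apply: (matching_unique (up _ vx vL) (up _ wx wL) (s := x)); rewrite !inE eqxx.
  have : v |: x \in [set x; w |: x]%SET by rewrite -e !inE eqxx orbT.
  rewrite !inE eq_sym (negbTE (pair_neq _ vx)) /= => /eqP/setP/(_ v).
  by rewrite !inE eqxx (negbTE vx) !orbF => /esym/eqP.
have down (r : {set V}) : r \in L -> x \subset r -> forall u, u \in r -> u |: x \in L.
  by move=> rL xr u ur; apply: dL rL _; rewrite finset.subUset finset.sub1set ur.
case: (boolP [exists v, (v \notin x) && (v |: x \in L)]) => [/existsP[v /andP[vx vL]]|nex].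
  have free (r : {set V}) : r \in L -> x \subset r -> r = x \/ r = v |: x.
    move=> rL xr; have rs : r \subset v |: x.
      apply/fintype.subsetP => u ur; rewrite !inE.
      case: (boolP (u \in x)) => ux; first by rewrite orbT.
      by rewrite (uniq_v _ _ vx vL ux (down _ rL xr _ ur)) eqxx.
    case: (boolP (v \in r)) => vr; [right|left]; apply/eqP;
      rewrite finset.eqEsubset ?rs ?xr ?andbT //.
      by rewrite finset.subUset finset.sub1set vr.
    apply/fintype.subsetP => u ur; have := fintype.subsetP rs _ ur.
    rewrite !inE => /orP[/eqP uv|//].
    by rewrite uv (negbTE vr) in ur.
  (* If the empty face is the source, its only proper coface is one vertex, and [L] is the base
     case. *)
  have [x0|x0] := eqVneq x finset.set0.
    have -> : L = vertex_complex v; last exact: Pv.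
    have vx1 : v |: x = [set v]%SET by rewrite x0 finset.setU0.
    apply/setP => r; rewrite !inE; apply/idP/orP => [rL|[]/eqP->]; last 2 first.
    - by [].
    - by rewrite -vx1.
    by have := free _ rL; rewrite x0 finset.sub0set finset.setU0 => /(_ isT)[]->; [left|right].
  apply: (Pcol L x v dL vL vx x0 free); apply: IH.
  - rewrite ltnS in lk; apply: leq_trans lk; apply: proper_card.
    by apply/properP; split; [exact: finset.subsetDl|exists x => //; rewrite !inE eqxx].
  - by apply: fintype.subset_trans LK; exact: finset.subsetDl.
  - move=> r t; rewrite !inE negb_or => /andP[/andP[tx tv] tL] rt.
    rewrite (dL _ _ tL rt) andbT negb_or.
    have xt : ~~ (x \subset t).
      by apply/negP => /(free _ tL)[] e; [rewrite e eqxx in tx|rewrite e eqxx in tv].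
    by apply/andP; split; apply: contraNneq xt => e; apply: fintype.subset_trans rt;
      rewrite e ?finset.subsetUr.
  - rewrite !inE L0 andbT negb_or eq_sym x0 eq_sym /=; apply/finset.set0Pn; exists v.
    by rewrite finset.setU11.
  - move=> e eM s t se te; rewrite !inE !negb_or => /andP[/andP[sx sv] sL].
    rewrite (closed _ eM _ _ se te sL) andbT.
    have ex := up _ vx vL.
    have ne r : r \in e -> r \in [set x; v |: x]%SET -> False.
      move=> re rx; have ee := matching_unique eM ex re rx.
      by move: se; rewrite ee !inE (negbTE sx) (negbTE sv).
    by apply/andP; split; apply/eqP => h; apply: (ne _ te); rewrite h !inE eqxx ?orbT.
have xmax (r : {set V}) : r \in L -> x \subset r -> r = x.
  move=> rL xr; apply/eqP; rewrite finset.eqEsubset xr andbT.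
  apply/fintype.subsetP => u ur; apply: contraNT nex => ux; apply/existsP; exists u.
  by rewrite ux (down _ rL xr).
(* A mate of [x] would lie in [L]: a larger one contradicts maximality, a smaller one has an arc
   into the source [x]. *)
have xc : x \in K :\: finset.cover M.
  rewrite inE (fintype.subsetP LK _ xL) andbT; apply/negP => /finset.bigcupP[e eM xe].
  have [s [t [c e_]]] := matching_edge eM.
  have sL r : r \in e -> r \in L by move=> re; exact: closed eM _ _ xe re xL.
  have [sLx tLx] : s \in L /\ t \in L by split; apply: sL; rewrite e_ !inE eqxx ?orbT.
  have /and4P[_ _ pst _] := c.
  move: xe; rewrite e_ !inE => /orP[]/eqP ex.
    have := xmax _ tLx; rewrite ex (proper_sub pst) => /(_ isT) ts.
    by move: pst; rewrite ts fintype.properxx.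
  by have := src _ sLx; rewrite /morse_arc ex c -e_ eM.
have x0 : x != finset.set0.
  by apply: contraTneq xc => ->; rewrite inE M0.
apply: (Pcrit L x dL xL xc xmax); apply: IH.
- by move: lk; rewrite (cardsD1 x) xL.
- by apply: fintype.subset_trans LK; exact: finset.subD1set.
- move=> r t; rewrite !inE => /andP[tx tL] rt; rewrite (dL _ _ tL rt) andbT.
  by apply: contraNneq tx => rx; apply/eqP/xmax => //; rewrite -rx.
- by rewrite !inE eq_sym x0.
move=> e eM s t se te; rewrite !inE => /andP[sx sL]; rewrite (closed _ eM _ _ se te sL) andbT.
apply: contraTneq xc => tx; rewrite inE negb_and negbK; apply/orP; left.
by apply/finset.bigcupP; exists e; rewrite // -tx.
Qed.

End morse.

Lemma vertex_realization (R : realType) (V : finType) (K : {set {set V}}) (v : V) :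
  [set v]%SET \in K -> geometric_realization R K (fun w => (w == v)%:R).
Proof.
move=> vK; split=> [w||]; first by rewrite ler0n.
  by rewrite (bigD1 v) //= eqxx big1 ?addr0 // => u /negbTE ->.
rewrite (_ : [set _ | _]%SET = [set v]%SET) //.
by apply/setP => w; rewrite !inE pnatr_eq0 eqb0 negbK.
Qed.

(** For [-1 <= k] the empty face, of dimension -1, is not critical, and its mate provides a vertex.
    For [j <= k] a critical face has at least [j.+2] elements, as [fills_push] requires. *)
Theorem morse_connected (R : realType) (V : finType) (K : {set {set V}})
    (M : {set {set {set V}}}) (k : int) :
  down_closed K -> finset.set0 \in K -> acyclic_matching K M ->
  (forall s, s \in K :\: finset.cover M -> k < face_dim s) ->
  k_connected R k (geometric_realization R K).
Proof.
move=> dK K0 aM crit.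
have M0 : -1 <= k -> finset.set0 \in finset.cover M.
  move=> k1; apply: contraTT k1 => M0; rewrite -ltNge.
  have := crit finset.set0; rewrite !inE M0 K0 => /(_ isT).
  by rewrite /face_dim cards0.
split=> [k1|j jk f /ptws_withinP cf fS].
  have /finset.bigcupP[e eM e0] := M0 k1.
  have [s [t [c e_]]] := matching_edge aM eM; have /and4P[_ tK st _] := c.
  have [v vt] : exists v, v \in t.
    by apply/card_gt0P; exact: leq_ltn_trans (proper_card st).
  exists (fun w => (w == v)%:R); apply: vertex_realization.
  by apply: dK tK _; rewrite finset.sub1set.
have fK : fills R j K.
  apply: (morse_induction dK aM K0 _ (@fills_vertex R V j)) => [|L s v|L s dL sL sc smax].
  - by apply: M0; apply: le_trans jk.
  - exact: fills_collapse.
  apply: fills_push => //; have := crit _ sc; rewrite /face_dim; move: jk.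
  lia.
have [g [cg gB gS]] := fK f cf (fun x Sx => fS _ (ex_intro2 _ _ x Sx erefl)).
by exists g; split=> //; [apply/ptws_withinP|move=> _ [x Bx <-]; exact: gB].
Qed.

(** A face of dimension i has i + 1 elements, and 3 (i + 1) + 1 = 3 i + 4. *)
Lemma critical_number0 (V : finType) (K : {set {set V}}) M (n : nat) (i : int) :
  (forall s, s \in K :\: finset.cover M -> n <= 3 * #|s| + 1)%N ->
  3 * i + 4 < n%:Z -> critical_number K M i = 0%N.
Proof.
move=> H lt; apply/eqP; rewrite cards_eq0; apply/eqP/setP => s; rewrite !inE.
apply/negP => /andP[sU /eqP ei]; have := H s; rewrite inE => /(_ sU).
by move: lt; rewrite -ei /face_dim; lia.
Qed.

Theorem theorem6p1 (R : realType) (n : nat) (hn : (1 <= n)%N) :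
  (exists M : {set {set {set {set 'I_n}}}},
     acyclic_matching (h_complex n) M /\
     forall i : int, 3 * i + 4 < n%:Z ->
       critical_number (h_complex n) M i = 0%N) /\
  k_connected R ((n%:Z - 5) %/ 3)%Z
    (geometric_realization R (h_complex n)).
Proof.
have [M [aM crit]] := h_complex_matching hn; split.
  by exists M; split=> // i; exact: critical_number0.
apply: (morse_connected _ (h_complex_down hn) _ aM).
  apply: (h_complex_down hn (t := descent_chain (1%g : 'S_n))); last exact: finset.sub0set.
  exact: imset_f.
(* The bound reads n - 4 <= 3 dim s, so the floor of (n - 5) / 3 is below dim s. *)
move=> s /crit; rewrite /face_dim; lia.
Qed.
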